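(* For every $\lambda>0$, the equation $$\mathcal{L}f=\lambda f$$ has at least one solution $f$ in $C_0^+[0,1]$.
   Context: Let $C^+[0,1]=\{f\in C[0,1]: f(x)\ge 0 \text{ for all } x\in[0,1]\}$ and $C_0^+[0,1]=C^+[0,1]\setminus\{\theta\}$, where $\theta\equiv 0$. Let $\xi_1:[0,1]^3\to\mathbb{R}$ and $\xi_2,\xi_3:[0,1]^2\to\mathbb{R}$ be bounded measurable functions and let $\beta>0$. Let the real parameters $J_3,J,J_1,\alpha$ be either all nonzero, or such that $J_3\neq0$ and $J=J_1=\alpha=0$. Put $$K(t,u,v)=\exp\{J_3\beta\xi_1(t,u,v)+J\beta\xi_2(u,v)+J_1\beta(\xi_3(t,u)+\xi_3(t,v))+\alpha\beta(u+v)\},\quad (t,u,v)\in[0,1]^3.$$ The Lyapunov integral operator $\mathcal{L}$ on $C[0,1]$ is defined by $$(\mathcal{L}f)(t)=\int_0^1\int_0^1K(t,s,u)f(s)f(u)\,ds\,du.$$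
   Formalization: That L maps C[0,1] into C[0,1] is made an explicit hypothesis: bounded measurable ξ's alone do not ensure it, and for ξ₁ = 1_{t>1/2}, J=J₁=α=0 the claim fails because Lf is discontinuous for every nonzero f ≥ 0. *)

(* Defs.v *)
From HB Require Import structures.
From mathcomp Require Import all_boot all_order all_algebra.
From mathcomp Require Import all_classical all_reals all_analysis.

Set Implicit Arguments.
Unset Strict Implicit.
Unset Printing Implicit Defensive.

Import Order.TTheory GRing.Theory Num.Theory.
Import numFieldNormedType.Exports.

Local Open Scope classical_set_scope.
Local Open Scope ring_scope.

Definition I01 {R : realType} : set R := `[0, 1].

(* Functions on [0,1], [0,1]^2 and [0,1]^3 are represented by total functions
   on R, R * R and R * R * R; only their values on the cubes below matter. *)
Definition I01_2 {R : realType} : set (R * R) := I01 `*` I01.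

Definition I01_3 {R : realType} : set (R * R * R) := I01 `*` I01 `*` I01.

Definition C01 {R : realType} : set (R -> R) :=
  [set f | {within I01, continuous f}].

Definition C01_nonneg {R : realType} : set (R -> R) :=
  [set f | C01 f /\ forall x, I01 x -> 0 <= f x].

(* theta is the function vanishing identically on [0,1]; its values outside
   [0,1] are irrelevant. *)
Definition C01_nonneg_nonzero {R : realType} : set (R -> R) :=
  C01_nonneg `\` [set f | forall x, I01 x -> f x = 0].

(* Borel measurability: the sections (s, u) |-> K (t, s, u) are then measurable
   for every t, so that the integral defining the operator makes sense
   pointwise. *)
Definition bounded_measurable d (T : measurableType d) (R : realType)
    (D : set T) (f : T -> R) : Prop :=
  measurable_fun D f /\ [bounded f x | x in D].

Definition kernelK (R : realType) (J3 J J1 alpha beta : R)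
    (xi1 : R * R * R -> R) (xi2 xi3 : R * R -> R) (t u v : R) : R :=
  expR (J3 * beta * xi1 (t, u, v) + J * beta * xi2 (u, v)
        + J1 * beta * (xi3 (t, u) + xi3 (t, v)) + alpha * beta * (u + v)).

Definition lyapunov (R : realType) (K : R -> R -> R -> R) (f : R -> R) : R -> R :=
  fun t => \int[@lebesgue_measure R]_(u in I01)
             \int[@lebesgue_measure R]_(s in I01) (K t s u * f s * f u).

(* Main.v *)
(** By homogeneity it suffices to solve [L f = c f] for some [c > 0] and some
    positive [f]: then [(lambda / c) f] is a solution for [lambda].

    [f] is a fixed point of the normalized operator [T g = L g / int L g], which
    preserves the densities [m / M <= g <= M / m], where [m <= K <= M].  The
    kernel is only measurable, so [L] need not be compact on [C[0,1]]; but [L]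
    turns weak convergence of bounded sequences into pointwise convergence,
    because its inner integral converges pointwise and boundedly.  This allows
    the Schauder scheme in the weak topology: averaging [T] over the cells of a
    partition of [0,1] gives a continuous self-map of a simplex, which has
    approximate fixed points; a subsequence of the resulting step functions
    converges weakly, and its limit is an exact fixed point.  Continuity of
    [f = L f / c] follows from [L : C[0,1] -> C[0,1]] because the continuous
    functions are dense in [L^1] and [L] is locally Lipschitz from [L^1] to the
    uniform norm.

    The finite-dimensional fixed points come from Scarf's combinatorial lemma,
    which replaces Sperner's lemma and needs no triangulation. *)

Require Import Defs.
From HB Require Import structures.
From mathcomp Require Import all_boot all_order all_algebra.
From mathcomp Require Import all_classical all_reals all_analysis.
From mathcomp Require Import measurable_realfun ring lra zify.

Set Implicit Arguments.
Unset Strict Implicit.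
Unset Printing Implicit Defensive.

Import Order.TTheory GRing.Theory Num.Theory.
Import numFieldNormedType.Exports.

Local Open Scope classical_set_scope.
Local Open Scope ring_scope.

(** * Scarf's lemma *)

Section Scarf.
Import mathcomp.boot.fintype mathcomp.boot.finset.
Local Open Scope nat_scope.
Local Open Scope set_scope.

(** Losing exactly one element in the image means that one fibre of [f] on [S] is a pair [{a, b}]
    and all others are singletons. A point can be removed without changing the image exactly when it
    lies in that pair. *)
Lemma collapse_pair (A B : finType) (f : A -> B) (S : {set A}) :
  #|S| = #|f @: S|.+1 ->
  exists a b, [/\ a \in S, b \in S, a != b &
    forall x, x \in S -> (f @: (S :\ x) == f @: S) = (x == a) || (x == b)].
Proof.
move=> cS.
have ninj : ~ {in S &, injective f}.
  by move=> /card_in_imset E; rewrite E in cS; lia.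
have [a [b [aS bS ab fab]]] : exists a b, [/\ a \in S, b \in S, a != b & f a = f b].
  apply: contrapT => H; apply: ninj => x y xS yS fxy.
  by apply/eqP; apply: contrapT => /negP xy; apply: H; exists x, y.
have key x y : x \in S -> y \in S -> x != y -> f x = f y ->
    f @: (S :\ x) = f @: S.
  move=> xS yS xy fxy; apply/eqP; rewrite eqEsubset imsetS ?subD1set//=.
  apply/subsetP => _ /imsetP[z zS ->].
  have [->|zx] := eqVneq z x; last by apply: imset_f; rewrite !inE zx.
  by rewrite fxy; apply: imset_f; rewrite !inE eq_sym xy.
exists a, b; split=> // x xS; apply/idP/idP.
- move=> /eqP fx; apply/negPn/negP; rewrite negb_or => /andP[xa xb].
  have /imset_injP inj : #|f @: (S :\ x)| == #|S :\ x|.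
    by rewrite fx -(eqn_add2l 1) add1n -cS (cardsD1 x S) xS.
  move/eqP: ab; apply; apply: inj => //; rewrite !inE.
    by rewrite eq_sym xa.
  by rewrite eq_sym xb.
- case/orP => /eqP->; apply/eqP; first exact: (key a b).
  by apply: (key b a) => //; rewrite eq_sym.
Qed.

Variables (T I : finType) (r : I -> T -> nat) (c : T -> I) (x0 : T).
Hypothesis r_inj : forall i, injective (r i).
Implicit Types (s t : {set T}) (C D : {set I}).

(** This is Scarf's primitive-set condition: no point lies strictly above the minimum of [s] in all
    the orders of [C] at once. *)
Definition dominant (s : {set T}) (C : {set I}) :=
  [forall y, exists i in C, forall x in s, r i y <= r i x].

Lemma dominantP s C :
  reflect (forall y, exists2 i, i \in C & forall x, x \in s -> r i y <= r i x)
          (dominant s C).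
Proof.
apply: (iffP forallP) => H y.
- by have /exists_inP[i iC /forall_inP] := H y; exists i.
- by have [i iC H'] := H y; apply/exists_inP; exists i => //; apply/forall_inP.
Qed.

Lemma dominantS s t C D :
  t \subset s -> C \subset D -> dominant s C -> dominant t D.
Proof.
move=> /subsetP ts /subsetP CD /dominantP H; apply/dominantP => y.
by have [i iC H'] := H y; exists i; [exact: CD | move=> x /ts /H'].
Qed.

Definition is_min s i x := (x \in s) && [forall y in s, r i x <= r i y].

Lemma is_minP s i x :
  reflect (x \in s /\ forall y, y \in s -> r i x <= r i y) (is_min s i x).
Proof. by apply: (iffP andP) => -[xs /forall_inP]. Qed.

Lemma is_min_inj s i x y : is_min s i x -> is_min s i y -> x = y.
Proof.
move=> /is_minP[xs Hx] /is_minP[ys Hy]; apply: (@r_inj i); apply/eqP.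
by rewrite eqn_leq Hx// Hy.
Qed.

Definition argmin (s : {set T}) i := odflt x0 [pick x | is_min s i x].

Lemma argmin_eq s i x : is_min s i x -> argmin s i = x.
Proof.
rewrite /argmin; case: pickP => /= [y Hy Hx|/(_ x)->//].
exact: is_min_inj Hy Hx.
Qed.

Lemma argminP s i : s != set0 -> is_min s i (argmin s i).
Proof.
move=> /set0Pn[x xs]; rewrite /argmin; case: pickP => //= H.
have [y ys Hy] := arg_minnP (r i) xs.
by have /is_minP[] := negbT (H y).
Qed.

(** Dominance applied to a point of [s] itself yields an order in which that point is the
    minimum. *)
Lemma argmin_onto s C : s != set0 -> dominant s C -> argmin s @: C = s.
Proof.
move=> s0 /dominantP H; apply/eqP; rewrite eqEsubset; apply/andP; split.
  by apply/subsetP => _ /imsetP[i _ ->]; have /is_minP[] := argminP i s0.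
apply/subsetP => x xs; have [i iC H'] := H x.
apply/imsetP; exists i => //; apply/esym/argmin_eq/is_minP; split=> //.
Qed.

Definition escapes (t : {set T}) (C : {set I}) y :=
  [forall i in C, exists z in t, r i z < r i y].

Lemma escapesP t C y :
  reflect (forall i, i \in C -> exists2 z, z \in t & r i z < r i y)
          (escapes t C y).
Proof.
by apply: (iffP forall_inP) => H i iC; have /exists_inP := H i iC.
Qed.

Lemma dominantN t C : ~~ dominant t C = [exists y, escapes t C y].
Proof.
rewrite negb_forall; apply: eq_existsb => y.
rewrite negb_exists_in; apply: eq_forallb_in => i _.
by rewrite negb_forall_in; apply: eq_existsb => z; rewrite -ltnNge.
Qed.

(* Rooms are the dominant pairs with #|s| = #|C|, doors the dominant pairs with
   #|t|.+1 = #|D|; a door belongs to a room if it is obtained from the room by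
   removing a point or by adding an index.  [scarf] counts modulo 2 the
   incidences between rooms and nearly colourful doors. *)
Definition room (R : {set T} * {set I}) := dominant R.1 R.2 && (#|R.1| == #|R.2|).

Definition incident (R E : {set T} * {set I}) :=
  (E.2 == R.2) && [exists x in ~: E.1, R.1 == x |: E.1] ||
  (E.1 == R.1) && [exists i in E.2, R.2 == E.2 :\ i].

(** In a room the minimizer map is a bijection from indices to points, so [x] is the minimizer of a
    single index [j]. The other indices already reach all of [t], and dominance bounds the remaining
    escaping points by [x] in the order [j]. *)
Lemma room_add_point t D x : t != set0 -> x \notin t -> #|D| = #|t|.+1 ->
  room (x |: t, D) ->
  exists j, [/\ j \in D, argmin t @: (D :\ j) = argmin t @: D,
    escapes t (D :\ j) x & forall y, escapes t (D :\ j) y -> r j y <= r j x].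
Proof.
move=> t0 xt cD /andP[/= dom /eqP card].
have ne : x |: t != set0 by apply/set0Pn; exists x; rewrite !inE eqxx.
have onto := argmin_onto ne dom.
have inj : {in D &, injective (argmin (x |: t))}.
  by apply/imset_injP; rewrite onto card.
have /dominantP domP := dom.
have [j jD jx] := domP x.
have jmin : argmin (x |: t) j = x.
  by apply/argmin_eq/is_minP; rewrite !inE eqxx.
have xesc : escapes t (D :\ j) x.
  apply/escapesP => i; rewrite !inE => /andP[ij iD]; apply: contrapT => H.
  move/eqP: ij; apply; apply: inj => //; rewrite jmin.
  apply/argmin_eq/is_minP; rewrite !inE eqxx; split=> // y.
  rewrite !inE => /predU1P[->//|yt]; rewrite leqNgt; apply/negP => yx.
  by apply: H; exists y.
exists j; split=> //.
- suff tS : t \subset argmin t @: (D :\ j).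
    have onS k : argmin t k \in t by have /is_minP[] := argminP k t0.
    apply/eqP; rewrite eqEsubset imsetS ?subD1set//=.
    by apply: subset_trans tS; apply/subsetP => _ /imsetP[k _ ->].
  apply/subsetP => y yt; have [i iD iy] := domP y.
  apply/imsetP; exists i; last first.
    apply/esym/argmin_eq/is_minP; split=> // z zt.
    by apply: iy; rewrite !inE zt orbT.
  rewrite !inE iD andbT; apply: contraNneq xt => ij.
  suff -> : x = y by [].
  apply: (@r_inj j); apply/eqP; rewrite eqn_leq jx ?inE ?yt ?orbT//=.
  by rewrite -ij iy// !inE eqxx.
- move=> y /escapesP yesc; have [i iD iy] := domP y.
  have [ij|ij] := eqVneq i j; first by rewrite -ij iy// !inE eqxx.
  have [|z zt zy] := yesc i; first by rewrite !inE ij.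
  by have := iy z; rewrite !inE zt orbT leqNgt zy => /(_ isT).
Qed.

(** Converse of [room_add_point]. A point that escapes the indices other than [j] is kept below [x]
    by the order [j]; any other point has a dominating index different from [j], which [x] respects
    because it escapes. *)
Lemma add_point_room t D j x : t != set0 -> #|D| = #|t|.+1 -> dominant t D ->
  j \in D -> argmin t @: (D :\ j) = argmin t @: D ->
  escapes t (D :\ j) x -> (forall y, escapes t (D :\ j) y -> r j y <= r j x) ->
  x \notin t /\ room (x |: t, D).
Proof.
move=> t0 cD dom jD im xesc xmax.
have xt : x \notin t.
  apply/negP; rewrite -{1}(argmin_onto t0 dom) -im => /imsetP[i iD xi].
  have /escapesP/(_ i iD)[z zt] := xesc.
  have /is_minP[_ /(_ z zt)] := argminP i t0.
  by rewrite -xi leqNgt => /negP.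
split=> //; rewrite /room/= cardsU1 xt cD eqxx andbT.
apply/dominantP => y; have /dominantP domP := dom.
have [yesc|] := boolP (escapes t (D :\ j) y).
  exists j => // z; rewrite !inE => /predU1P[->|zt]; first exact: xmax.
  have [i iD iy] := domP y.
  have [<-|ij] := eqVneq i j; first exact: iy.
  have /escapesP/(_ i)[|w wt wy] := yesc; first by rewrite !inE ij.
  by have := iy w wt; rewrite leqNgt wy.
rewrite negb_forall_in => /exists_inP[i iD].
rewrite negb_exists_in => /forall_inP H.
have iy z : z \in t -> r i y <= r i z by move=> /H; rewrite -leqNgt.
exists i; first by move: iD; rewrite !inE => /andP[].
move=> z; rewrite !inE => /predU1P[->|]; last exact: iy.
have /escapesP/(_ i iD)[w wt /ltnW] := xesc.
exact/leq_trans/iy.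
Qed.

(** Scarf's pivot: after giving up the index [j], dominance is restored by adding the escaping point
    that is highest in the order [j]. If nothing escapes, dropping [j] already yields a room. *)
Definition next_room (t : {set T}) (D : {set I}) (j : I) :=
  if [pick x | escapes t (D :\ j) x &&
               [forall y, escapes t (D :\ j) y ==> (r j y <= r j x)]]
  is Some x then (x |: t, D) else (t, D :\ j).

Lemma next_roomP t D j : t != set0 -> #|D| = #|t|.+1 -> dominant t D ->
  j \in D -> argmin t @: (D :\ j) = argmin t @: D -> 
  [/\ room (next_room t D j), incident (next_room t D j) (t, D) &
    next_room t D j = (t, D :\ j) \/
    exists2 x, next_room t D j = (x |: t, D) & x \notin t /\ escapes t (D :\ j) x].
Proof.
move=> t0 cD dom jD im; rewrite /next_room; case: pickP => [x|none].
  move=> /andP[xesc /forallP H].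
  have xmax y : escapes t (D :\ j) y -> r j y <= r j x.
    by move=> yesc; exact: (implyP (H y)).
  have [xt xroom] := add_point_room t0 cD dom jD im xesc xmax.
  split=> //; last by right; exists x.
  apply/orP; left; rewrite eqxx/=; apply/exists_inP; exists x => //.
  by rewrite !inE.
split; last by left.
- rewrite /room/= -(eqn_add2l (j \in D)) -cardsD1 jD add1n cD eqxx andbT.
  apply: contraT; rewrite dominantN => /existsP[y yesc].
  have [x xesc xmax] := arg_maxnP (r j) yesc.
  have /negP[] := negbT (none x); rewrite xesc/=.
  by apply/forallP => z; apply/implyP => /xmax.
- by apply/orP; right; rewrite eqxx/=; apply/exists_inP; exists j.
Qed.

(* Exactly two indices [a], [b] of [D] have the same minimizer in [t], and the two
   rooms of the door are the ones that arise by dropping [a], resp. [b]. *)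
Lemma door_two_rooms t D : t != set0 -> #|D| = #|t|.+1 -> dominant t D ->
  #|[set R | room R & incident R (t, D)]| = 2.
Proof.
move=> t0 cD dom.
have [] := @collapse_pair _ _ (argmin t) D; first by rewrite argmin_onto.
move=> a [b [aD bD ab Hab]].
have ima : argmin t @: (D :\ a) = argmin t @: D.
  by apply/eqP; rewrite Hab// eqxx.
have imb : argmin t @: (D :\ b) = argmin t @: D.
  by apply/eqP; rewrite Hab// eqxx orbT.
have [rooma inca casea] := next_roomP t0 cD dom aD ima.
have [roomb incb caseb] := next_roomP t0 cD dom bD imb.
have neq : next_room t D a != next_room t D b.
  apply/eqP => E; case: casea => [Ea|[x Ea [xt xesc]]].
    case: caseb => [Eb|[y Eb [yt yesc]]]; rewrite -E Ea in Eb.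
      case: Eb => /setP/(_ a); rewrite !inE eqxx aD andbT/= => /esym/eqP.
      by rewrite (negbTE ab) => /eqP.
    by case: Eb => _ /setP/(_ a); rewrite !inE eqxx aD.
  case: caseb => [Eb|[y Eb [yt yesc]]]; rewrite -E Ea in Eb.
    by case: Eb => _ /setP/(_ b); rewrite !inE eqxx bD.
  case: Eb => /setP/(_ y); rewrite !inE eqxx (negbTE yt) orbF => /eqP yx.
  (* One point cannot serve both pivots: the index that dominance of the door gives for [x] differs
     from [a] or from [b], and [x] escapes [D] without that one. *)
  rewrite {}yx {y} in yt yesc.
  have /dominantP/(_ x)[i iD ix] := dom.
  have [ia|ia] := eqVneq i a.
    have /escapesP/(_ i)[|z zt zx] := yesc; first by rewrite !inE ia ab.
    by have := ix z zt; rewrite leqNgt zx.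
  have /escapesP/(_ i)[|z zt zx] := xesc; first by rewrite !inE ia.
  by have := ix z zt; rewrite leqNgt zx.
suff -> : [set R | room R & incident R (t, D)] =
          [set next_room t D a; next_room t D b] by rewrite cards2 neq.
apply/setP => -[s C]; rewrite !inE; apply/idP/idP; last first.
  by case/orP => /eqP ->; apply/andP.
move=> /andP[sroom]; rewrite /incident /= => /orP[|].
  move=> /andP[/eqP E /exists_inP[x]]; rewrite inE => xt /eqP sx.
  rewrite -{}E {}sx {s C} in sroom *.
  have [j [jD imj xesc xmax]] := room_add_point t0 xt cD sroom.
  suff -> : (x |: t, D) = next_room t D j.
    by have := Hab j jD; rewrite imj eqxx => /esym/orP[] /eqP ->;
      rewrite eqxx ?orbT.
  rewrite /next_room; case: pickP => [y /andP[yesc /forallP H]|/(_ x)].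
    suff -> : x = y by [].
    apply: (@r_inj j); apply/eqP; rewrite eqn_leq xmax// andbT.
    exact: (implyP (H x)).
  rewrite xesc/= => /negP[]; apply/forallP => y; apply/implyP.
  exact: xmax.
move=> /andP[/eqP E /exists_inP[j jD /eqP sj]].
rewrite -{}E {}sj {s C} in sroom *.
have /andP[/= domj _] := sroom.
suff -> : (t, D :\ j) = next_room t D j.
  have := Hab j jD; rewrite argmin_onto// argmin_onto// eqxx.
  by move=> /esym/orP[] /eqP ->; rewrite eqxx ?orbT.
rewrite /next_room; case: pickP => // x /andP[xesc _].
suff : ~~ dominant t (D :\ j) by rewrite domj.
by rewrite dominantN; apply/existsP; exists x.
Qed.

(** Dropping the index would leave the empty index set, which dominates nothing, so the only room
    adds the top point of the order [i]. This door is the source of the odd parity in [scarf]. *)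
Lemma door0_one_room i : #|[set R | room R & incident R (set0, [set i])]| = 1.
Proof.
have [x _ xmax] := arg_maxnP (r i) (erefl : predT x0).
apply/eqP/cards1P; exists ([set x], [set i]).
apply/setP => -[s C]; rewrite !inE; apply/idP/idP.
  move=> /andP[/andP[/= /dominantP dom _]]; rewrite /incident /= => /orP[|].
    move=> /andP[/eqP Ci /exists_inP[y _ /eqP sy]].
    rewrite -Ci setU0 in dom sy *.
    have [j] := dom x; rewrite inE => /eqP ->; rewrite sy => /(_ y).
    rewrite !inE eqxx => /(_ isT) xy.
    suff -> : y = x by rewrite eqxx.
    by apply: (@r_inj i); apply/eqP; rewrite eqn_leq xy andbT; exact: xmax.
  move=> /andP[_ /exists_inP[j]]; rewrite inE => /eqP -> /eqP Ci.
  by have [k] := dom x; rewrite Ci setDv inE.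
move=> /eqP[-> ->]; rewrite /room/= !cards1 eqxx andbT; apply/andP; split.
  apply/dominantP => y; exists i; first by rewrite inE.
  by move=> _ /set1P ->; exact: xmax.
rewrite /incident/= eqxx/=; apply/orP; left; apply/exists_inP; exists x.
  by rewrite !inE.
by rewrite setU0.
Qed.

Definition nearly_colourful i0 (E : {set T} * {set I}) :=
  [&& i0 \in E.2, c @: E.1 == E.2 :\ i0 & #|E.2| == #|E.1|.+1].

(** Such a room has either no nearly colourful door or exactly two, as in the path-following proof
    of Sperner's lemma. *)
Lemma room_even_doors i0 R : room R -> c @: R.1 != R.2 ->
  ~~ odd #|[set E | nearly_colourful i0 E & incident R E]|.
Proof.
case: R => s C /andP[/= dom /eqP card] ncol.
set X := [set E | _ & _].
have [->|] := eqVneq X set0; first by rewrite cards0.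
have type1 x : x \in s -> incident (s, C) (s :\ x, C).
  move=> xs; apply/orP; left; rewrite eqxx/=; apply/exists_inP; exists x.
    by rewrite !inE eqxx.
  by rewrite setD1K.
have type2 i : i \notin C -> incident (s, C) (s, i |: C).
  move=> iC; apply/orP; right; rewrite eqxx/=; apply/exists_inP; exists i.
    by rewrite !inE eqxx.
  by rewrite setU1K.
have incP E : incident (s, C) E ->
    (exists2 x, x \in s & E = (s :\ x, C)) \/
    (exists2 i, i \notin C & E = (s, i |: C)).
  case: E => t D; rewrite /incident/= => /orP[]/andP[/eqP -> /exists_inP[x]].
    by rewrite inE => xt /eqP sx; left; exists x; rewrite sx ?setU1K// !inE eqxx.
  by move=> xD /eqP ->; right; exists x; rewrite ?setD1K// !inE eqxx.
have cardsx x : x \in s -> #|C| = #|s :\ x|.+1.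
  by move=> xs; rewrite -card (cardsD1 x s) xs.
move=> /set0Pn[E0]; rewrite inE => /andP[nE0 iE0].
(* Either a colour [i] outside [C] replaces [i0], and the doors remove the unique point of that
   colour or add the index [i]. Or the colours are [C] without [i0], two points share a colour, and
   the doors remove one of them. *)
have [[i iC [i0C cs]]|[i0C cs]] :
  (exists2 i, i \notin C & i0 \in C /\ c @: s = (i |: C) :\ i0) \/
  (i0 \in C /\ c @: s = C :\ i0).
- have [[x xs E]|[i iC E]] := incP _ iE0.
    move: nE0; rewrite E => /and3P[/= i0C /eqP cx _].
    have cs : c @: s = c x |: C :\ i0 by rewrite -cx -imsetU1 setD1K.
    have cxi0 : c x != i0.
      by apply: contraNneq ncol => cxi0; rewrite /= cs cxi0 setD1K.
    have [cxC|cxC] := boolP (c x \in C).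
      by right; split=> //; rewrite cs; apply/setUidPr; rewrite sub1set !inE cxi0.
    left; exists (c x) => //; split=> //; rewrite cs.
    by apply/setP => z; rewrite !inE; case: (eqVneq z (c x)) => [->|//]; rewrite cxi0.
  move: nE0; rewrite E => /and3P[/=]; rewrite !inE => /predU1P[i0i|i0C] /eqP cs _.
    by move: ncol; rewrite /= cs i0i setU1K// eqxx.
  by left; exists i.
- have i0i : i != i0 by apply: contraNneq iC => ->.
  have cardiC : #|(i |: C) :\ i0| = #|s|.
    by have := cardsD1 i0 (i |: C); rewrite !inE i0C orbT cardsU1 iC card; lia.
  have inj : {in s &, injective c} by apply/imset_injP; rewrite cs cardiC.
  have : i \in c @: s by rewrite cs !inE i0i eqxx.
  move=> /imsetP[y ys iy].
  suff -> : X = [set (s :\ y, C); (s, i |: C)].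
    rewrite cards2 xpair_eqE negb_and.
    suff -> : s :\ y != s by [].
    by apply: contraTneq ys => <-; rewrite !inE eqxx.
  apply/setP => E; rewrite !inE; apply/idP/idP.
    move=> /andP[nE /incP[[x xs EE]|[j jC EE]]]; rewrite {}EE {E} in nE *.
      move: nE => /and3P[_ /= /eqP cx _].
      suff -> : x = y by rewrite eqxx.
      apply: inj => //; rewrite -iy.
      have : i \in c @: s by rewrite iy imset_f.
      by rewrite -(setD1K xs) imsetU1 cx !inE (negbTE iC) andbF orbF => /eqP.
    move: nE => /and3P[_ /= /eqP]; rewrite cs => /setP/(_ i).
    rewrite !inE i0i eqxx/= (negbTE iC) orbF => /esym/eqP -> _.
    by rewrite eqxx orbT.
  case/orP => /eqP ->; rewrite ?type1 ?type2// andbT; apply/and3P; split => //=.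
  + rewrite eqEcard; apply/andP; split.
      apply/subsetP => _ /imsetP[z + ->]; rewrite !inE => /andP[zy zs].
      have : c z \in c @: s by rewrite imset_f.
      rewrite cs !inE => /andP[-> /= /predU1P[czi|//]].
      by move/eqP: zy; case; apply: inj => //; rewrite czi.
    have inj' : {in s :\ y &, injective c}.
      by move=> u v; rewrite !inE => /andP[_ us] /andP[_ vs]; exact: inj.
    rewrite (card_in_imset inj').
    by have := cardsx _ ys; have := cardsD1 i0 C; rewrite i0C; lia.
  + by rewrite (cardsx _ ys).
  + by rewrite !inE i0C orbT.
  + by rewrite cs.
  + by rewrite cardsU1 iC card add1n.
- have [|a [b [aS bS ab Hab]]] := @collapse_pair _ _ c s.
    by rewrite cs card; have := cardsD1 i0 C; rewrite i0C; lia.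
  suff -> : X = [set (s :\ a, C); (s :\ b, C)].
    rewrite cards2 xpair_eqE eqxx andbT.
    suff -> : s :\ a != s :\ b by [].
    apply/eqP => /setP/(_ a); rewrite !inE eqxx aS andbT /=.
    by rewrite (negbTE ab).
  apply/setP => E; rewrite !inE; apply/idP/idP.
    move=> /andP[nE /incP[[x xs EE]|[j jC EE]]]; rewrite {}EE {E} in nE *.
      move: nE => /and3P[_ /= cx _]; have := Hab x xs; rewrite cs cx.
      by move=> /esym/orP[] /eqP ->; rewrite eqxx ?orbT.
    move: nE => /and3P[_ /= /eqP]; rewrite cs => /setP/(_ j).
    rewrite !inE eqxx (negbTE jC) andbF andbT => /esym/negbT; rewrite negbK => /eqP ji0.
    by move: jC; rewrite ji0 i0C.
  case/orP => /eqP ->; rewrite type1// andbT; apply/and3P; split => //=.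
  + by rewrite -cs Hab// eqxx.
  + by rewrite (cardsx _ aS).
  + by rewrite -cs Hab// eqxx orbT.
  + by rewrite (cardsx _ bS).
Qed.

Theorem scarf : exists s C, dominant s C /\ c @: s = C.
Proof.
apply: contrapT => H.
have ncol R : room R -> c @: R.1 != R.2.
  by move=> /andP[dom _]; apply/eqP => cR; apply: H; exists R.1, R.2.
pose i0 := c x0; pose E0 : {set T} * {set I} := (set0, [set i0]).
pose N := \sum_(R | room R) \sum_(E | nearly_colourful i0 E) (incident R E : nat).
have cardE (V : finType) (P Q : pred V) :
    \sum_(E | P E) (Q E : nat) = #|[set E | P E & Q E]|.
  rewrite -sum1dep_card big_mkcondr/=; apply: eq_bigr => E _.
  by case: (Q E).
have evenN : ~~ odd N.
  rewrite /N; apply: (big_ind (fun n => ~~ odd n)) => //.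
    by move=> m n; rewrite oddD => /negbTE-> /negbTE->.
  by move=> R rR; rewrite cardE room_even_doors// ncol.
have nE0 : nearly_colourful i0 E0.
  by rewrite /nearly_colourful/= inE eqxx imset0 setDv eqxx cards0 cards1.
(* Summed over doors first, the count is odd: [E0] contributes one and every other door an even
   number. *)
move: evenN; rewrite /N exchange_big/= (bigD1 E0)//= cardE door0_one_room.
rewrite oddD/= negbK => /negP; apply; apply/negP.
apply: (big_ind (fun n => ~~ odd n)) => //.
  by move=> m n; rewrite oddD => /negbTE-> /negbTE->.
move=> [t D] /andP[/and3P[/= i0D /eqP ct /eqP cD] neE0]; rewrite cardE.
(* A pair that is not dominant belongs to no room, since dominance survives removing points and
   adding indices. *)
have [dom|ndom] := boolP (dominant t D); last first.
  rewrite (_ : [set R | _ & _] = set0) ?cards0//.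
  apply/setP => -[s C]; rewrite !inE; apply/negbTE; apply: contra ndom.
  move=> /andP[/andP[/= dom _]]; rewrite /incident/= => /orP[].
    move=> /andP[/eqP -> /exists_inP[x _ /eqP sx]]; apply: dominantS dom => //.
    by rewrite sx subsetUr.
  move=> /andP[/eqP -> /exists_inP[i _ /eqP Ci]]; apply: dominantS dom => //.
  by rewrite Ci subD1set.
rewrite door_two_rooms//; apply: contraNneq neE0 => t0.
rewrite /E0 t0; apply/eqP; congr pair; apply/setP => i.
move: ct; rewrite t0 imset0 => /setP/(_ i); rewrite !inE.
by case: eqVneq => [->|//] /=; rewrite ?i0D// => _ <-.
Qed.
End Scarf.

(** * Approximate fixed points on a simplex *)

Section Grid.
Local Open Scope nat_scope.
Variables (m N : nat).
Import mathcomp.boot.fintype mathcomp.boot.finset.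
Local Open Scope set_scope.

(** Numerators of the points of the standard [m]-simplex whose barycentric coordinates have
    denominator [N]. *)
Definition grid := {f : {ffun 'I_m.+1 -> 'I_N.+1} | \sum_i f i == N}.

Definition coord (f : grid) i : nat := val f i.

Lemma coord_sum f : \sum_i coord f i = N.
Proof. exact/eqP/(valP f). Qed.

Lemma grid_of (y : 'I_m.+1 -> nat) : \sum_i y i = N ->
  exists f : grid, forall i, coord f i = y i.
Proof.
move=> yN.
have yle i : y i < N.+1 by rewrite ltnS -yN (bigD1 i)//= leq_addr.
pose g : {ffun 'I_m.+1 -> 'I_N.+1} := [ffun i => Ordinal (yle i)].
have gi i : g i = y i :> nat by rewrite ffunE.
have gN : \sum_i g i == N by apply/eqP/(etrans _ yN)/eq_bigr => i _.
by exists (Sub g gN) => i; rewrite /coord SubK.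
Qed.

(* ties between equal coordinates are broken by the enumeration of the grid *)
Definition grid_rank (i : 'I_m.+1) (f : grid) : nat :=
  coord f i * #|{: grid}| + enum_rank f.

Lemma grid_rank_inj i : injective (grid_rank i).
Proof.
move=> f g /(congr1 (modn^~ #|{: grid}|)).
by rewrite /grid_rank !modnMDl !modn_small// => /ord_inj/enum_rank_inj.
Qed.

Lemma grid_rank_le i f g : grid_rank i f <= grid_rank i g ->
  coord f i <= coord g i.
Proof.
have card0 : 0 < #|{: grid}| by apply/card_gt0P; exists f.
move=> /(leq_div2r #|{: grid}|).
by rewrite /grid_rank !divnMDl// !divn_small// !addn0.
Qed.

(** Plays the part of a small full-coloured simplex in Sperner's lemma. A colour may be missing, but
    only where the corresponding coordinate is negligible on all of [s]. *)
Lemma grid_scarf (c : grid -> 'I_m.+1) : exists s : {set grid},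
  [/\ s != set0,
   forall f g i, f \in s -> g \in s -> coord f i <= coord g i + m.+1 &
   forall f i, f \in s ->
     (exists2 g, g \in s & c g = i) \/ coord f i <= m.+1].
Proof.
have [x0 _] : exists f : grid, forall i, coord f i = if i == ord0 then N else 0.
  by apply: grid_of; rewrite -big_mkcond big_pred1_eq.
have [s [C [/dominantP dom cs]]] := scarf c x0 grid_rank_inj.
(* Dominance of any point forces [C], and hence [s], to be nonempty. *)
have [i1 i1C _] := dom x0.
have [f0 f0s _] : exists2 f, f \in s & i1 = c f by apply/imsetP; rewrite cs.
pose mu i := coord [arg min_(f < f0 in s) coord f i] i.
have mule f i : f \in s -> mu i <= coord f i.
  by move=> fs; rewrite /mu; case: arg_minnP => //= g _; exact.
(* Otherwise some grid point exceeds the minimum of [s] in every coordinate of [C], against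
   dominance. The witness [y] takes [mu i + 1] on [C] and puts the surplus on [i1]. *)
have muS : N < \sum_(i in C) (mu i).+1.
  rewrite ltnNge; apply/negP => leN.
  pose y i := if i == i1 then N - \sum_(j in C | j != i1) (mu j).+1
              else if i \in C then (mu i).+1 else 0.
  have leN' := leN; rewrite (bigD1 i1)//= in leN'.
  have [f yf] : exists f, forall i, coord f i = y i.
    apply: grid_of; rewrite (bigD1 i1)//= /y eqxx.
    have -> : \sum_(i < m.+1 | i != i1)
        (if i == i1 then N - \sum_(j in C | j != i1) (mu j).+1
         else if i \in C then (mu i).+1 else 0) =
        \sum_(j in C | j != i1) (mu j).+1.
      rewrite [RHS](eq_bigl (fun j => (j != i1) && (j \in C))); last first.
        by move=> j; rewrite andbC.
      by rewrite [RHS]big_mkcondr; apply: eq_bigr => i /negbTE ->.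
    by rewrite subnK//; apply: leq_trans leN'; rewrite leq_addl.
  have [i iC Hi] := dom f.
  have [g gs gi] : exists2 g, g \in s & mu i = coord g i.
    by rewrite /mu; case: arg_minnP => //= g gs _; exists g.
  have := grid_rank_le (Hi g gs); rewrite yf -gi /y iC.
  case: eqVneq => [->|_]; last by rewrite ltnn.
  move: leN'; move: (\sum_(j in C | j != i1) (mu j).+1) => S.
  by move=> *; lia.
have sumC f : \sum_(i in C) coord f i + \sum_(i | i \notin C) coord f i = N.
  by rewrite -(coord_sum f) [RHS](bigID (mem C)).
have cardC : #|C| <= m.+1 by rewrite -[leqRHS]card_ord max_card.
(* The minima over [C] use up [N] except for less than [m + 1]; no coordinate outside [C], and no
   excess over a minimum, can be larger than this remainder. *)
have muS' : N < \sum_(i in C) mu i + m.+1.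
  apply: leq_trans muS _; under eq_bigr do rewrite -addn1.
  by rewrite big_split/= sum1_card leq_add2l.
have outC f i : f \in s -> i \notin C -> coord f i <= m.+1.
  move=> fs iC.
  have le1 : coord f i <= \sum_(j | j \notin C) coord f j.
    by rewrite (bigD1 i)//= leq_addr.
  have le2 : \sum_(j in C) mu j <= \sum_(j in C) coord f j.
    by apply: leq_sum => j _; exact: mule.
  move: (sumC f) muS' le1 le2.
  move: (\sum_(j in C) mu j) (\sum_(j in C) coord f j) => u v.
  by move: (\sum_(j | j \notin C) coord f j) => w; lia.
have inC f i : f \in s -> i \in C -> coord f i <= mu i + m.+1.
  move=> fs iC.
  have le1 : \sum_(j in C | j != i) mu j <= \sum_(j in C | j != i) coord f j.
    by apply: leq_sum => j _; exact: mule.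
  move: (sumC f) muS'; rewrite !(bigD1 i iC)/=; move: le1.
  move: (\sum_(j in C | j != i) mu j) (\sum_(j in C | j != i) coord f j) => u v.
  by move: (\sum_(j | j \notin C) coord f j) => w; lia.
exists s; split.
- by apply/set0Pn; exists f0.
- move=> f g i fs gs; have [iC|iC] := boolP (i \in C).
    by apply: leq_trans (inC f i fs iC) _; rewrite leq_add2r mule.
  by apply: leq_trans (outC f i fs iC) _; rewrite leq_addl.
- move=> f i fs; have [iC|iC] := boolP (i \in C); last by right; exact: outC.
  by left; have /imsetP[g gs ->] : i \in c @: s; [rewrite cs|exists g].
Qed.
End Grid.

Section ApproxFixpoint.
Variables (R : realType) (m : nat).

Definition simplex (x : 'I_m.+1 -> R) := (forall i, 0 <= x i) /\ \sum_i x i = 1.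

(** A grid point is coloured by a coordinate that [T] does not decrease. Near a point of the set
    from [grid_scarf] every coordinate is then almost not decreased, and equality of the coordinate
    sums turns this into two-sided closeness. *)
Theorem approx_fixpoint (T : ('I_m.+1 -> R) -> 'I_m.+1 -> R) :
  (forall x, simplex x -> simplex (T x)) ->
  (forall e, 0 < e -> exists2 d, 0 < d & forall x y, simplex x -> simplex y ->
     (forall i, `|x i - y i| <= d) -> forall i, `|T x i - T y i| <= e) ->
  forall e, 0 < e -> exists2 x, simplex x & forall i, `|T x i - x i| <= e.
Proof.
move=> Tsimp Tcont e e0.
pose M : R := m.+1%:R.
have M0 : 0 < M by rewrite ltr0n.
(* Each coordinate may lose [2 * eta], and the losses of all [m + 1] coordinates must add up to at
   most [e]. *)
pose eta := e / (2 * M).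
have eta0 : 0 < eta by rewrite divr_gt0// mulr_gt0.
have [d d0 Hd] := Tcont eta eta0.
pose k := Num.truncn (M / Num.min d eta).
have mn0 : 0 < Num.min d eta by rewrite lt_min d0.
pose N : R := k.+1%:R.
have N0 : 0 < N by rewrite ltr0n.
have Nmin : M / N <= Num.min d eta.
  rewrite ler_pdivrMr// mulrC -ler_pdivrMr//.
  by rewrite ltW// /N truncnS_gt// .
have Nd : M / N <= d by rewrite (le_trans Nmin)// ge_min lexx.
have Neta : M / N <= eta by rewrite (le_trans Nmin)// ge_min lexx orbT.
have etaE : 2 * eta * M = e by rewrite /eta; field; rewrite gt_eqF.
clearbody eta.
pose p (f : grid m k.+1) i : R := (coord f i)%:R / N.
have psimp f : simplex (p f).
  split=> [i|]; first by rewrite divr_ge0.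
  by rewrite -mulr_suml -natr_sum coord_sum divff// gt_eqF.
(* A strict decrease in every coordinate would contradict the common sum 1. *)
have Tp f : exists i, p f i <= T (p f) i.
  apply: contrapT => H.
  have lt i : T (p f) i < p f i.
    by rewrite ltNge; apply/negP => le; apply: H; exists i.
  have [_ s1] := psimp f; have [_ s2] := Tsimp _ (psimp f).
  have : \sum_i T (p f) i < \sum_i p f i.
    by apply: ltr_sum => //; apply/hasP; exists ord0; rewrite ?mem_index_enum.
  by rewrite s1 s2 ltxx.
have [c Hc] := choice Tp.
have [s [/set0Pn[z zs] close cover]] := grid_scarf c.
exists (p z) => //.
have pclose f g i : f \in s -> g \in s -> p f i - p g i <= M / N.
  move=> fs gs; rewrite -mulrBl ler_pM2r ?invr_gt0// lerBlDl -natrD ler_nat.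
  exact: close.
have pclose' f g i : f \in s -> g \in s -> `|p f i - p g i| <= d.
  move=> fs gs; apply: le_trans Nd; rewrite ler_norml pclose// andbT.
  by rewrite lerNl opprB pclose.
(* A nearby point [g] of colour [i] costs one [eta] for the coordinate and one for [T]. Without such
   a point the coordinate itself is at most [eta], and [T] is nonnegative. *)
have low i : p z i - 2 * eta <= T (p z) i.
  case: (cover z i zs) => [[g gs gi]|zi].
    have := Hd _ _ (psimp g) (psimp z) (fun j => pclose' g z j gs zs) i.
    have := Hc g; rewrite gi; have := le_trans (pclose z g i zs gs) Neta.
    by rewrite ler_norml => ? ? /andP[? ?]; lra.
  have [T0 _] := Tsimp _ (psimp z).
  have : p z i <= eta by apply: le_trans Neta; rewrite ler_pM2r ?invr_gt0// ler_nat.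
  by have := T0 i; lra.
move=> i; rewrite ler_norml; apply/andP; split.
  have : 2 * eta <= 2 * eta * M by rewrite ler_peMr /M ?ler1n//; lra.
  by rewrite etaE; have := low i; lra.
(* The upper bound on coordinate [i] follows from the lower bounds on all the others. *)
have [_ s1] := psimp z; have [_ s2] := Tsimp _ (psimp z).
have : \sum_(j | j != i) (p z j - 2 * eta) <= \sum_(j | j != i) T (p z) j.
  by apply: ler_sum => j _; exact: low.
have E1 := s1; have E2 := s2; rewrite (bigD1 i)//= in E1; rewrite (bigD1 i)//= in E2.
rewrite big_split/= sumr_const => H.
have : (2 * eta) *+ #|[pred j | j != i]| <= 2 * eta * M.
  by rewrite -mulr_natr ler_pM2l ?mulr_gt0// /M ler_nat -[leqRHS]card_ord max_card.
rewrite etaE.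
move: H; rewrite mulNrn; lra.
Qed.
End ApproxFixpoint.

(** * Bounded measurable functions on the unit interval *)

Section BoundedMeasurable.
Variable R : realType.
Implicit Types f g : R -> R.

Definition bmeas f := measurable_fun setT f /\ exists B, forall x, `|f x| <= B.

Definition int01 f : R := \int[@lebesgue_measure R]_(x in I01) f x.

Lemma measurable_I01 : measurable (@I01 R).
Proof. exact: measurable_itv. Qed.

Lemma lebesgue_I01 : lebesgue_measure (@I01 R) = 1%E.
Proof. by rewrite lebesgue_measure_itv/= lte_fin ltr01 -EFinD subr0. Qed.

Lemma bmeas_integrable f :
  bmeas f -> (@lebesgue_measure R).-integrable I01 (EFin \o f).
Proof.
move=> [mf [B fB]]; apply: measurable_bounded_integrable.
- exact: measurable_I01.
- by rewrite [X in (X < _)%E]lebesgue_I01 ltry.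
- exact: measurable_funTS.
- by exists B; split; rewrite ?num_real// => M BM x _; apply: le_trans (fB x) (ltW BM).
Qed.
Hint Resolve measurable_I01 bmeas_integrable : core.

Lemma bmeas_cst c : bmeas (fun=> c).
Proof. by split; [exact: measurable_cst|exists `|c|]. Qed.

Lemma bmeasD f g : bmeas f -> bmeas g -> bmeas (fun x => f x + g x).
Proof.
move=> [mf [A fA]] [mg [B gB]]; split; first exact: measurable_funD.
by exists (A + B) => x; rewrite (le_trans (ler_normD _ _))// lerD.
Qed.

Lemma bmeasM f g : bmeas f -> bmeas g -> bmeas (fun x => f x * g x).
Proof.
move=> [mf [A fA]] [mg [B gB]]; split; first exact: measurable_funM.
by exists (A * B) => x; rewrite normrM ler_pM.
Qed.

Lemma bmeasB f g : bmeas f -> bmeas g -> bmeas (fun x => f x - g x).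
Proof.
move=> [mf [A fA]] [mg [B gB]]; split; first exact: measurable_funB.
by exists (A + B) => x; rewrite (le_trans (ler_normB _ _))// lerD.
Qed.

Lemma bmeas_norm f : bmeas f -> bmeas (fun x => `|f x|).
Proof.
move=> [mf [A fA]]; split; first exact: measurableT_comp.
by exists A => x; rewrite normr_id.
Qed.

Lemma bmeas_indic (A : set R) : measurable A -> bmeas (\1_A).
Proof.
move=> mA; split; first exact: measurable_indic.
by exists 1 => x; rewrite indicE; case: (x \in A); rewrite ?normr1 ?normr0.
Qed.

Lemma bmeas_sum n (F : 'I_n -> R -> R) : (forall i, bmeas (F i)) ->
  bmeas (fun x => \sum_i F i x).
Proof.
elim: n F => [|n IH] F bF.
  by under [X in bmeas X]eq_fun do rewrite big_ord0; exact: bmeas_cst.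
under [X in bmeas X]eq_fun do rewrite big_ord_recl; apply: bmeasD => //.
by apply: IH => i; exact: bF.
Qed.

Lemma eq_int01 f g : (forall x, I01 x -> f x = g x) -> int01 f = int01 g.
Proof. by move=> fg; apply: eq_Rintegral => x /set_mem; exact: fg. Qed.

Lemma int01_cst c : int01 (fun=> c) = c.
Proof.
rewrite /int01 Rintegral_cst; last exact: measurable_I01.
by rewrite [X in fine X]lebesgue_I01 mulr1.
Qed.

Lemma int01D f g : bmeas f -> bmeas g ->
  int01 (fun x => f x + g x) = int01 f + int01 g.
Proof. by move=> bf bg; apply: RintegralD; auto. Qed.

Lemma int01B f g : bmeas f -> bmeas g ->
  int01 (fun x => f x - g x) = int01 f - int01 g.
Proof. by move=> bf bg; apply: RintegralB; auto. Qed.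

Lemma int01Z c f : bmeas f -> int01 (fun x => c * f x) = c * int01 f.
Proof. by move=> bf; apply: RintegralZl; auto. Qed.

Lemma le_int01 f g : bmeas f -> bmeas g ->
  (forall x, I01 x -> f x <= g x) -> int01 f <= int01 g.
Proof. by move=> bf bg fg; apply: le_Rintegral; auto. Qed.

Lemma int01_ge0 f : (forall x, I01 x -> 0 <= f x) -> 0 <= int01 f.
Proof. by move=> f0; apply: Rintegral_ge0. Qed.

Lemma norm_int01 f : bmeas f -> `|int01 f| <= int01 (fun x => `|f x|).
Proof. by move=> bf; apply: le_normr_Rintegral; auto. Qed.

Lemma int01_sum n (F : 'I_n -> R -> R) : (forall i, bmeas (F i)) ->
  int01 (fun x => \sum_i F i x) = \sum_i int01 (F i).
Proof.
elim: n F => [|n IH] F bF.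
  by under eq_fun do rewrite big_ord0; rewrite int01_cst big_ord0.
under eq_fun do rewrite big_ord_recl; rewrite int01D//; last first.
  by apply: bmeas_sum => i; exact: bF.
by rewrite big_ord_recl IH// => i; exact: bF.
Qed.

Lemma int01_bound f B : bmeas f -> (forall x, I01 x -> `|f x| <= B) ->
  `|int01 f| <= B.
Proof.
move=> bf fB; rewrite (le_trans (norm_int01 bf))// -[leRHS]int01_cst.
by apply: le_int01 => //; [exact: bmeas_norm|exact: bmeas_cst].
Qed.

Lemma int01_indic (A : set R) : measurable A -> A `<=` I01 ->
  int01 (\1_A) = fine (lebesgue_measure A).
Proof.
move=> mA AI; rewrite /int01 /Rintegral integral_indic//; by rewrite setIidl.
Qed.

Lemma int01_cvg (f_ : nat -> R -> R) f B : (forall n, bmeas (f_ n)) ->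
  bmeas f -> (forall n x, I01 x -> `|f_ n x| <= B) ->
  (forall x, I01 x -> f_ n x @[n --> \oo] --> f x) ->
  int01 (f_ n) @[n --> \oo] --> int01 f.
Proof.
move=> bf_ bf fB ff.
have [] := @dominated_convergence _ _ _ (@lebesgue_measure R) I01
  measurable_I01 (fun n => EFin \o f_ n) (EFin \o f) (fun=> B%:E).
- by move=> n; apply/measurable_EFinP/measurable_funTS; case: (bf_ n).
- by apply/measurable_EFinP/measurable_funTS; case: bf.
- by apply: aeW => x /= xI; apply/fine_cvgP; split; [exact: nearW|exact: ff].
- exact: (bmeas_integrable (bmeas_cst B)).
- by apply: aeW => x n xI /=; rewrite lee_fin fB.
move=> _ _ H; apply: fine_cvg; rewrite fineK//.
by apply: integrable_fin_num => //; exact: bmeas_integrable.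
Qed.

End BoundedMeasurable.
#[global] Hint Resolve measurable_I01 bmeas_integrable bmeas_cst : core.

(** * Weak convergence *)

Section WeakConvergence.
Import HBSimple.
Variables (R : realType) (J : Type) (F : set_system J).
Context {FF : Filter F}.
Variables (d : J -> R -> R) (B : R).
Hypotheses (md : forall j, measurable_fun setT (d j))
           (dB : forall j x, `|d j x| <= B).

Let bd j : bmeas (d j). Proof. by split=> //; exists B. Qed.

(** The filter is arbitrary because the notion serves both for sequences and, along a product filter
    on pairs of indices, for weak Cauchy sequences. *)
Definition weakly_null (phi : R -> R) :=
  int01 (fun s => phi s * d j s) @[j --> F] --> (0 : R).

Lemma weakly_nullD phi psi : bmeas phi -> bmeas psi ->
  weakly_null phi -> weakly_null psi -> weakly_null (fun s => phi s + psi s).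
Proof.
move=> bphi bpsi wphi wpsi; rewrite /weakly_null.
have -> : (fun j => int01 (fun s => (phi s + psi s) * d j s)) =
    (fun j => int01 (fun s => phi s * d j s) + int01 (fun s => psi s * d j s)).
  apply/funext => j; rewrite -int01D; [|exact: bmeasM..].
  by apply: eq_int01 => x _; rewrite mulrDl.
have := cvgD wphi wpsi; rewrite addr0; exact.
Qed.

Lemma weakly_nullZ c phi : bmeas phi ->
  weakly_null phi -> weakly_null (fun s => c * phi s).
Proof.
move=> bphi wphi; rewrite /weakly_null.
have -> : (fun j => int01 (fun s => (c * phi s) * d j s)) =
    (fun j => c * int01 (fun s => phi s * d j s)).
  apply/funext => j; rewrite -int01Z; last exact: bmeasM.
  by apply: eq_int01 => x _; rewrite mulrA.
by have := cvgM (cvg_cst c) wphi; rewrite mulr0; exact.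
Qed.

Lemma weakly_null_sum n (h : 'I_n -> R -> R) : (forall i, bmeas (h i)) ->
  (forall i, weakly_null (h i)) -> weakly_null (fun s => \sum_i h i s).
Proof.
elim: n h => [|n IH] h bh wh.
  rewrite /weakly_null.
  have -> : (fun j => int01 (fun s => (\sum_(i < 0) h i s) * d j s)) = fun=> 0.
    apply/funext => j; rewrite -[RHS](int01_cst (R:=R)).
    by apply: eq_int01 => x _; rewrite big_ord0 mul0r.
  exact: cvg_cst.
have -> : (fun s => \sum_i h i s) =
    (fun s => h ord0 s + \sum_i h (lift ord0 i) s).
  by apply/funext => s; rewrite big_ord_recl.
by apply: weakly_nullD => //; [exact: bmeas_sum|exact: IH].
Qed.

(** Replacing [phi] by [psi] changes the integrals by at most the uniform bound on [d] times the L1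
    distance. The factor [|B| + 1] is used below since it is positive whatever [B] is. *)
Lemma weakly_null_L1_closed phi : bmeas phi ->
  (forall e, 0 < e -> exists psi,
     [/\ bmeas psi, weakly_null psi & int01 (fun s => `|phi s - psi s|) <= e]) ->
  weakly_null phi.
Proof.
move=> bphi H; apply/cvgr0Pnorm_le => e e0.
have B0 : 0 < `|B| + 1 by rewrite ltr_wpDl.
have [|psi [bpsi wpsi le]] := H (e / 2 / (`|B| + 1)).
  by rewrite !divr_gt0.
have e20 : 0 < e / 2 by rewrite divr_gt0.
move/cvgr0Pnorm_le : wpsi => /(_ _ e20); apply: filterS => j Hj.
rewrite (@eq_int01 _ _ (fun s => psi s * d j s + (phi s - psi s) * d j s)); last first.
  by move=> x _; ring.
have b3 : bmeas (fun s => (phi s - psi s) * d j s) by exact/bmeasM/bd/bmeasB.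
rewrite int01D//; last exact/bmeasM.
rewrite (le_trans (ler_normD _ _))// [leRHS](splitr e) lerD//.
rewrite (le_trans (norm_int01 b3))//.
rewrite (@le_trans _ _ (int01 (fun s => (`|B| + 1) * `|phi s - psi s|)))//.
  have b4 : bmeas (fun s => `|phi s - psi s|) by exact/bmeas_norm/bmeasB.
  apply: le_int01; [exact: bmeas_norm|exact: bmeasM|].
  move=> x _; rewrite normrM mulrC ler_wpM2r// (le_trans (dB j x))//.
  by rewrite (le_trans (ler_norm B))// lerDl.
rewrite int01Z; last exact/bmeas_norm/bmeasB.
by rewrite mulrC -ler_pdivlMr.
Qed.

Hypothesis rays : forall x, weakly_null (\1_(`]-oo, x[%classic : set R)).

(** Dynkin's pi-lambda argument, the open left rays being a generating pi-system. *)
Lemma weakly_null_set (A : set R) : measurable A -> weakly_null (\1_A).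
Proof.
(* On [0,1] the whole line and the ray below 2 have the same indicator. *)
have setT_null : weakly_null (\1_[set: R]).
  rewrite /weakly_null; under eq_fun => j.
    rewrite (@eq_int01 _ _ (fun s => \1_(`]-oo, 2[%classic : set R) s * d j s)); last first.
      move=> x /=; rewrite /I01/= !indicE in_setT in_itv/= => /andP[_ x1].
      by rewrite mem_set//= in_itv/= (le_lt_trans x1)// ltr1n.
    over.
  exact: rays.
move=> mA;  have mG := RGenInftyO.measurableE R.
refine (@dynkin_induction _ (measurableTypeR R) (@RGenInftyO.G R)
  (fun A => weakly_null (\1_A)) mG _ setT_null _ _ _ A _).
- move=> _ _ [x ->] [y ->]; exists (Num.min x y).
  by apply/seteqP; split=> z /=; rewrite !in_itv/= lt_min; [move=> [-> ->]|move=> /andP].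
- by move=> _ [x ->]; exact: rays.
- move=> S mS wS; rewrite (_ : \1_(~` S) = (fun s => \1_[set: R] s + (-1) * \1_S s)); last first.
    apply/funext => s; rewrite !indicE in_setT in_setC.
    by case: (s \in S) => /=; rewrite ?mulr1 ?mulr0 ?subrr ?addr0.
  have bS : bmeas (\1_S : R -> R) by exact: bmeas_indic.
  apply: weakly_nullD => //; [exact: bmeas_indic|exact: bmeasM|exact: weakly_nullZ].
- move=> E mE' tE wE.
  have mE n : measurable (E n : set R) by exact: mE'.
  have mUk k : measurable (\big[setU/set0]_(i < k) E i : set R).
    by apply: bigsetU_measurable => i _; exact: mE.
  have wU k : weakly_null (\1_(\big[setU/set0]_(i < k) E i)).
    elim: k => [|k IH].
      rewrite big_ord0 /weakly_null.
      have -> : (fun j => int01 (fun s => \1_(set0 : set R) s * d j s)) = fun=> 0.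
        apply/funext => j; rewrite -[RHS]int01_cst.
        by apply: eq_int01 => x _; rewrite indic0 mul0r.
      exact: cvg_cst.
    rewrite big_ord_recr/=.
    rewrite (_ : \1_(_ `|` _) = (fun s =>
        \1_(\big[setU/set0]_(i < k) E i) s + \1_(E k) s)); last first.
      apply/funext => s; rewrite !indicE in_setU.
      case: (boolP (s \in \big[setU/set0]_(i < k) E i)) => /= h1;
        case: (boolP (s \in E k)) => /= h2; rewrite ?addr0 ?add0r//.
      move: h1 => /set_mem; rewrite -bigcup_mkord => -[i /= ik Eis].
      have := tE i k I I (ex_intro _ s (conj Eis (set_mem h2))).
      by move: ik => /[swap] ->; rewrite ltnn.
    by apply: weakly_nullD => //; exact: bmeas_indic.
  have mU : measurable (\bigcup_k E k) by exact: bigcup_measurable.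
  (* The finite unions converge to the countable one in L1, by dominated convergence. *)
  apply: weakly_null_L1_closed; first exact: bmeas_indic.
  move=> e e0.
  have : int01 (fun s => `|\1_(\bigcup_k E k) s - \1_(\big[setU/set0]_(i < n) E i) s| : R)
      @[n --> \oo] --> int01 (fun=> 0 : R).
    apply: (@int01_cvg _ _ _ 1) => //.
    - by move=> n; apply/bmeas_norm/bmeasB; exact: bmeas_indic.
    - move=> n x _; rewrite normr_id !indicE.
      by case: (_ \in _); case: (_ \in _); rewrite ?subrr ?subr0 ?sub0r ?normrN ?normr0 ?normr1.
    - move=> x _; apply: cvg_near_cst.
      have [[k _ Ekx]|nE] := pselect ((\bigcup_k E k) x).
        exists k.+1 => // n /= kn; rewrite !indicE !mem_set ?subrr ?normr0//.
          by rewrite -bigcup_mkord; exists k.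
        by exists k.
      apply: nearW => n; rewrite !indicE !memNset ?subrr ?normr0//.
      by rewrite -bigcup_mkord => -[k _ Ekx]; apply: nE; exists k.
  rewrite int01_cst => /cvgr0Pnorm_le/(_ e e0)[n _ /(_ n (leqnn n)) Hn].
  exists (\1_(\big[setU/set0]_(i < n) E i)); split=> //.
    exact: bmeas_indic.
  by rewrite (le_trans (ler_norm _)).
- by move: (mA); rewrite [X in X A]mG.
Qed.

(** Simple functions are combinations of indicators and are dense in L1. *)
Theorem weakly_null_bmeas phi : bmeas phi -> weakly_null phi.
Proof.
move=> bphi; apply: weakly_null_L1_closed => // e e0.
have [g_ [_ _]] := @approximation_sfun_integrable _ (measurableTypeR R) R
  (@lebesgue_measure R) I01 (@measurable_I01 R) (EFin \o phi) (bmeas_integrable bphi).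
move=> /fine_fcvg/cvgr0Pnorm_le/(_ e e0)[n _ /(_ n (leqnn n))/= Hn].
have bg : bmeas (g_ n).
  split.
    move=> mT Y mY; exact: (@measurable_funPT _ _ (measurableTypeR R) _ (g_ n) mT Y mY).
  have [M [_ HM]] := simple_bounded (g_ n).
  by exists (M + 1) => x; apply: (HM (M + 1)) => //; rewrite ltrDl.
exists (g_ n); split=> //; last by apply: le_trans Hn; apply: ler_norm.
have mpre r : measurable (g_ n @^-1` [set r] : set R).
  by rewrite -[X in measurable X]setTI; apply: bg.1 => //; exact: measurable_set1.
have bpre r : bmeas (\1_(g_ n @^-1` [set r]) : R -> R).
  exact: bmeas_indic.
have E := funext (fimfunEord (g_ n)); rewrite E.
apply: weakly_null_sum => i; first exact: bmeasM.
by apply: weakly_nullZ => //; exact: weakly_null_set.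
Qed.

End WeakConvergence.

(** * Extraction of pointwise convergent subsequences *)

Section Subsequence.
Variable R : realType.

Lemma cvgn_approx (a : nat -> R) :
  (forall e, 0 < e -> exists2 b : nat -> R, cvgn b & forall n, `|a n - b n| <= e) ->
  cvgn a.
Proof.
move=> H; apply/cauchy_cvgP/cauchy_exP => e e0.
have e20 : 0 < e / 2 by rewrite divr_gt0.
have e30 : 0 < e / 2 / 2 by rewrite divr_gt0.
have [b cb ab] := H _ e30.
exists (limn b); move/cvgrPdist_le : cb => /(_ _ e30); apply: filterS => n /= bn.
rewrite /ball/= (_ : _ - _ = (limn b - b n) - (a n - b n)); last by ring.
rewrite (le_lt_trans (ler_normB _ _))// (@le_lt_trans _ _ (e / 2))//.
  by rewrite [leRHS]splitr lerD.
by rewrite ltr_pdivrMr// mulr_natr mulr2n ltrDl.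
Qed.

(** A Helly-type selection: Tychonoff's theorem gives a cluster point of the values at the
    rationals, and the common Lipschitz constant carries convergence over to every real. Only
    [n <= phi n] is recorded, which suffices for passing to limits. *)
Lemma pointwise_cvg_subsequence (G : nat -> R -> R) (B C : R) :
  (forall n x, `|G n x| <= B) ->
  (forall n x y, `|G n x - G n y| <= C * `|x - y|) ->
  exists2 phi : nat -> nat, (forall n, (n <= phi n)%N) &
    forall x, cvgn (fun n => G (phi n) x).
Proof.
move=> GB GL.
(* [q] enumerates the rationals; numbers that code no rational are sent to 0. *)
pose q (k : nat) : R := ratr (odflt 0 (unpickle k : option rat)).
pose X := prod_topology (fun _ : nat => R).
pose K : set X := [set f | forall k, `[- B, B]%classic (f k)].
have cK : compact K.
  exact: (@tychonoff _ (fun _ : nat => R : topologicalType) _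
    (fun _ => @segment_compact R (- B) B)).
pose u n : X := fun k => G n (q k).
have [|g [_ gcl]] := cK (u @ \oo).
  exists 0%N => // n _ k /=; rewrite in_itv/=; have := GB n (q k).
  by rewrite ler_norml.
have FF : Filter (nbhs (g : X)) by exact: nbhs_filter.
have near_g N e : 0 < e -> nbhs (g : X) [set f | forall k, (k < N)%N -> `|f k - g k| < e].
  move=> e0; elim: N => [|N IH].
    by apply: (@filterS _ _ FF setT) filterT => f _ k; rewrite ltn0.
  have pN : nbhs (g : X) [set f | `|f N - g N| < e].
    have := @proj_continuous _ (fun _ : nat => R) N g.
    move/cvgrPdist_lt => /(_ e e0); apply: (@filterS _ _ FF) => f /=.
    by rewrite distrC.
  apply: (@filterS _ _ FF) (filterI IH pN) => f [/= h1 h2] k; rewrite ltnS leq_eqVlt.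
  by move=> /predU1P[->//|]; exact: h1.
(* Diagonal choice: the [N]-th index is good for the first [N] rationals simultaneously. *)
have ex N : exists n, (N <= n)%N /\ forall k, (k < N)%N -> `|u n k - g k| < N.+1%:R^-1.
  have [||f [[n /= Nn <-] Hf]] := gcl [set u n | n in [set n | (N <= n)%N]]
    [set f | forall k, (k < N)%N -> `|f k - g k| < N.+1%:R^-1].
  - by exists N => // n /= Nn; exists n.
  - by apply: near_g; rewrite invr_gt0.
  by exists n; split.
have [phi Hphi] := choice ex.
exists phi; first by move=> n; have [] := Hphi n.
have cq k : cvgn (fun n => G (phi n) (q k)).
  apply/cvg_ex; exists (g k); apply/cvgrPdist_lt => e e0.
  near=> n.
  have [_ /(_ k)] := Hphi n.
  rewrite distrC => H; apply: lt_trans (H _) _.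
    by near: n; exists k.+1.
  by near: n; exact: near_infty_natSinv_lt (PosNum e0).
move=> x; apply: cvgn_approx => e e0.
have C0 : 0 < `|C| + 1 by rewrite ltr_wpDl.
have [r] : exists r : rat, (x < ratr r < x + e / (`|C| + 1)).
  have [|r] := @rat_in_itvoo R x (x + e / (`|C| + 1)).
    by rewrite ltrDl divr_gt0.
  by rewrite in_itv/=; exists r.
move=> /andP[xr rx].
exists (fun n => G (phi n) (q (pickle r))) => // n.
rewrite (le_trans (GL _ _ _))// /q pickleK/= distrC gtr0_norm ?subr_gt0//.
rewrite (@le_trans _ _ ((`|C| + 1) * (ratr r - x)))//.
  by apply: ler_wpM2r; [rewrite subr_ge0 ltW|rewrite (le_trans (ler_norm C))// lerDl].
by rewrite mulrC -ler_pdivlMr// lerBlDl ltW.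
Unshelve. all: by end_near.
Qed.
End Subsequence.

(** * The Lyapunov operator on bounded measurable functions *)

Section Kernel.
Variables (R : realType) (k : R -> R -> R -> R) (m M : R).
Hypotheses (m0 : 0 < m) (mk : forall t s u, m <= k t s u)
  (kM : forall t s u, k t s u <= M)
  (meask : forall t, measurable_fun setT (fun p : R * R => k t p.1 p.2)).

Definition inner t (g : R -> R) u := int01 (fun s => k t s u * g s).

Let k_ge0 t s u : 0 <= k t s u. Proof. exact/ltW/lt_le_trans/mk. Qed.
Let norm_k t s u : `|k t s u| <= M. Proof. by rewrite ger0_norm. Qed.
Lemma M_ge0 : 0 <= M. Proof. exact: le_trans (k_ge0 0 0 0) (kM _ _ _). Qed.

Lemma bmeas_k t u : bmeas (fun s => k t s u).
Proof.
split; last by exists M.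
exact: (measurable_fun_pair1 u (meask t)).
Qed.

Lemma bmeas_kM t u g : bmeas g -> bmeas (fun s => k t s u * g s).
Proof. exact/bmeasM/bmeas_k. Qed.

Lemma norm_inner t g u : bmeas g -> `|inner t g u| <= M * int01 (fun s => `|g s|).
Proof.
move=> bg; rewrite (le_trans (norm_int01 (bmeas_kM t u bg)))//.
rewrite -int01Z; last exact: bmeas_norm.
apply: le_int01; first exact/bmeas_norm/bmeas_kM.
  by apply: bmeasM => //; exact: bmeas_norm.
by move=> x _; rewrite normrM ler_wpM2r.
Qed.

(** Tonelli's theorem, with the restriction to [0,1] moved into the integrand as an indicator. *)
Lemma measurable_inner_ge0 t g : bmeas g -> (forall x, 0 <= g x) ->
  measurable_fun setT (inner t g).
Proof.
move=> bg g0.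
pose f (p : R * R) : \bar R := (k t p.1 p.2 * (g p.1 * \1_(@I01 R) p.1))%:E.
have mf : measurable_fun setT f.
  apply/measurable_EFinP; apply: measurable_funM; first exact: meask.
  apply: measurable_funM.
    by apply: (measurableT_comp bg.1); exact: measurable_fst.
  apply: (measurableT_comp (measurable_indic (@measurable_I01 R))).
  exact: measurable_fst.
have f0 p : (0 <= f p)%E by rewrite lee_fin !mulr_ge0.
have := @measurable_fun_fubini_tonelli_G _ _ (measurableTypeR R) (measurableTypeR R) R
  (@lebesgue_measure R) f mf f0.
move=> mG.
have -> : inner t g = fine \o fubini_G (@lebesgue_measure R) f.
  apply/funext => u; rewrite /inner /int01 /Rintegral integral_mkcond/=.
  congr fine; apply: eq_integral => s _; rewrite patchE /f/= indicE.
  by case: (s \in I01); rewrite ?mulr1// !mulr0.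
have mG' : measurable_fun [set: R] (fubini_G (@lebesgue_measure R) f) by exact: mG.
exact: (measurableT_comp (fine_measurable measurableT) mG').
Qed.

Lemma bmeas_inner t g : bmeas g -> bmeas (inner t g).
Proof.
move=> bg; split; last by exists (M * int01 (fun s => `|g s|)) => u; exact: norm_inner.
have [B gB] := bg.2.
(* Adding the bound [B] makes the function nonnegative, so that Tonelli applies to both terms. *)
have E : inner t g = (fun u => inner t (fun s => g s + B) u - inner t (fun=> B) u).
  apply/funext => u; rewrite /inner -int01B; [|apply: bmeas_kM..] => //.
    by apply: eq_int01 => s _; ring.
  exact: bmeasD.
rewrite E; have B0 : 0 <= B by exact: le_trans (gB 0).
apply: measurable_funB; apply: measurable_inner_ge0 => //; first exact: bmeasD.
by move=> x; have := gB x; rewrite ler_norml -lerBlDr sub0r => /andP[].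
Qed.

Lemma lyapunovE g t : bmeas g ->
  lyapunov k g t = int01 (fun u => inner t g u * g u).
Proof.
move=> bg; apply: eq_int01 => u _; rewrite mulrC -int01Z; last exact: bmeas_kM.
by apply: eq_int01 => s _; rewrite mulrC.
Qed.

Lemma inner_diff t f g u : bmeas f -> bmeas g ->
  inner t f u - inner t g u = inner t (fun s => f s - g s) u.
Proof.
move=> bf bg; rewrite /inner -int01B; [|exact: bmeas_kM..].
by apply: eq_int01 => s _; rewrite mulrBr.
Qed.

(** The operator is the diagonal of a bilinear form, so the difference splits as in the product
    rule, and [norm_inner] bounds each inner integral by an L1 norm. *)
Lemma lyapunov_lipschitz f g t : bmeas f -> bmeas g ->
  `|lyapunov k f t - lyapunov k g t| <=
  M * (int01 (fun s => `|f s|) + int01 (fun s => `|g s|)) *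
    int01 (fun s => `|f s - g s|).
Proof.
move=> bf bg; rewrite !lyapunovE//.
have bfg : bmeas (fun s => f s - g s) by exact: bmeasB.
have bif := bmeas_inner t bf; have big := bmeas_inner t bg.
have bid := bmeas_inner t bfg.
rewrite -int01B; [|exact: bmeasM..].
rewrite (@eq_int01 _ _ (fun u => inner t (fun s => f s - g s) u * f u +
    inner t g u * (f u - g u))); last first.
  by move=> u _; rewrite -inner_diff//; ring.
rewrite int01D; [|exact: bmeasM..].
rewrite (le_trans (ler_normD _ _))// mulrDr mulrDl lerD//.
- rewrite (le_trans (norm_int01 (bmeasM bid bf)))// mulrAC -int01Z; last exact: bmeas_norm.
  apply: le_int01; first exact/bmeas_norm/bmeasM.
    by apply: bmeasM => //; exact: bmeas_norm.
  by move=> x _; rewrite normrM ler_wpM2r// norm_inner.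
- rewrite (le_trans (norm_int01 (bmeasM big bfg)))// -int01Z; last exact: bmeas_norm.
  apply: le_int01; first exact/bmeas_norm/bmeasM.
    by apply: bmeasM => //; exact: bmeas_norm.
  by move=> x _; rewrite normrM ler_wpM2r// norm_inner.
Qed.

Lemma lyapunov_bounds g t : bmeas g -> (forall x, 0 <= g x) -> int01 g = 1 ->
  m <= lyapunov k g t <= M.
Proof.
move=> bg g0 g1; rewrite lyapunovE//.
have bi := bmeas_inner t bg.
have low u : m <= inner t g u.
  rewrite -[leLHS]mulr1 -g1 -int01Z//; apply: le_int01.
  - exact: bmeasM.
  - exact: bmeas_kM.
  - by move=> x _; rewrite ler_wpM2r.
have upp u : inner t g u <= M.
  rewrite -[leRHS]mulr1 -g1 -int01Z//; apply: le_int01.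
  - exact: bmeas_kM.
  - exact: bmeasM.
  - by move=> x _; rewrite ler_wpM2r.
apply/andP; split.
  rewrite -[leLHS]mulr1 -g1 -int01Z//; apply: le_int01.
  - exact: bmeasM.
  - exact: bmeasM.
  - by move=> x _; rewrite ler_wpM2r.
rewrite -[leRHS]mulr1 -g1 -int01Z//; apply: le_int01.
- exact: bmeasM.
- exact: bmeasM.
- by move=> x _; rewrite ler_wpM2r.
Qed.

Lemma lyapunov_bounded g : bmeas g ->
  forall t, `|lyapunov k g t| <= M * int01 (fun s => `|g s|) * int01 (fun s => `|g s|).
Proof.
move=> bg t; have := lyapunov_lipschitz t bg (bmeas_cst 0).
rewrite (_ : lyapunov k (fun=> 0) t = 0); last first.
  rewrite lyapunovE; last exact: bmeas_cst.
  rewrite (@eq_int01 _ _ (fun=> 0)) ?int01_cst// => u _.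
  by rewrite mulr0.
rewrite (@eq_int01 _ (fun=> `|0|) (fun=> 0)) ?int01_cst; last by move=> *; rewrite normr0.
by rewrite subr0 addr0 (@eq_int01 _ (fun s => `|g s - 0|) (fun s => `|g s|))// => s _; rewrite subr0.
Qed.

(* [Lambda phi] is the weak limit tested against [phi]; it need not be known to
   be an integral at this point. *)
Lemma lyapunov_cvg (g_ : nat -> R -> R) (B : R) (Lambda : (R -> R) -> R) :
  (forall n, bmeas (g_ n)) -> (forall n x, `|g_ n x| <= B) ->
  (forall phi, bmeas phi ->
     int01 (fun s => phi s * g_ n s) @[n --> \oo] --> Lambda phi) ->
  forall t, lyapunov k (g_ n) t @[n --> \oo] -->
    Lambda (fun u => Lambda (fun s => k t s u)).
Proof.
move=> bg gB cg t.
pose h u := Lambda (fun s => k t s u).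
have hcv u : inner t (g_ n) u @[n --> \oo] --> h u by apply: cg; exact: bmeas_k.
have B0 : 0 <= B by exact: le_trans (gB 0%N 0).
have iB n u : `|inner t (g_ n) u| <= M * B.
  apply: int01_bound; first exact: bmeas_kM.
  by move=> s _; rewrite normrM ler_pM.
have hB u : `|h u| <= M * B.
  rewrite -(cvg_lim _ (cvg_norm (hcv u)))//.
  by apply: limr_le; [apply: is_cvg_norm; apply/cvg_ex; exists (h u)|exact: nearW].
have bh : bmeas h.
  split; last by exists (M * B).
  apply: (@measurable_fun_cvg _ _ _ _ (fun n => inner t (g_ n))) => //.
  by move=> n; case: (bmeas_inner t (bg n)).
have bi n := bmeas_inner t (bg n).
have bd n : bmeas (fun u => inner t (g_ n) u - h u) by exact: bmeasB.
(* The first term tests [g_ n] against the fixed function [h]. The second vanishes because the inner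
   integrals converge pointwise and boundedly while [g_ n] stays bounded. *)
have E n : lyapunov k (g_ n) t =
    int01 (fun u => h u * g_ n u) + int01 (fun u => (inner t (g_ n) u - h u) * g_ n u).
  rewrite lyapunovE// -int01D; [|exact: bmeasM..].
  by apply: eq_int01 => u _; ring.
rewrite (eq_cvg _ _ E) -[Lambda _]addr0; apply: cvgD; first exact: cg.
have cv0 : int01 (fun u => `|inner t (g_ n) u - h u| * B) @[n --> \oo] --> int01 (fun=> 0 : R).
  apply: (@int01_cvg _ _ _ ((M * B + M * B) * B)) => //.
  - by move=> n; apply: bmeasM => //; exact: bmeas_norm.
  - move=> n x _; rewrite normrM normr_id (ger0_norm B0) ler_wpM2r//.
    by rewrite (le_trans (ler_normB _ _))// lerD.
  - move=> x _; rewrite -[X in _ --> X](mul0r B); apply: cvgMl.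
    rewrite -(normr0 R) -(subrr (h x)); apply: cvg_norm.
    by apply: cvgB => //; exact: cvg_cst.
rewrite int01_cst in cv0.
apply/cvgr0Pnorm_le => e e0; move/cvgr0Pnorm_le : cv0 => /(_ e e0).
apply: filterS => n; apply: le_trans; apply: le_trans (ler_norm _).
rewrite (le_trans (norm_int01 (bmeasM (bd n) (bg n))))//.
apply: le_int01; first exact/bmeas_norm/bmeasM.
  by apply: bmeasM => //; exact: bmeas_norm.
by move=> x _; rewrite normrM ler_wpM2l.
Qed.

Lemma lyapunovZ g a t : bmeas g ->
  lyapunov k (fun x => a * g x) t = a ^+ 2 * lyapunov k g t.
Proof.
move=> bg; have bag : bmeas (fun x => a * g x) by exact: bmeasM.
have big := bmeas_inner t bg.
rewrite !lyapunovE// -int01Z; last exact: bmeasM.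
apply: eq_int01 => u _.
have -> : inner t (fun x => a * g x) u = a * inner t g u.
  rewrite /inner -int01Z; last exact: bmeas_kM.
  by apply: eq_int01 => s _; rewrite mulrCA.
by ring.
Qed.

End Kernel.

(** * Retraction of the line onto the unit interval *)

Section Clamp.
Variable R : realType.

Definition clamp (x : R) : R := Num.max 0 (Num.min x 1).

Lemma clamp_I01 x : I01 (clamp x).
Proof.
rewrite /I01/= in_itv/= /clamp le_max lexx/= ge_max ler01/=.
by rewrite ge_min lexx orbT.
Qed.

Lemma clamp_id x : I01 x -> clamp x = x.
Proof.
rewrite /I01/= in_itv/= => /andP[x0 x1].
by rewrite /clamp min_l// max_r.
Qed.

Lemma clamp_lipschitz x y : `|clamp x - clamp y| <= `|x - y|.
Proof.
have cP z : [\/ z <= 0 /\ clamp z = 0, 0 <= z <= 1 /\ clamp z = z |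
    1 <= z /\ clamp z = 1].
  have [z0|/ltW z0] := leP z 0.
    by constructor 1; rewrite /clamp max_l// ge_min z0.
  have [z1|/ltW z1] := leP z 1; first by constructor 2; rewrite clamp_id ?z0// /I01/= in_itv/= z0.
  by constructor 3; rewrite /clamp min_r// max_r.
have mono a b : a <= b -> 0 <= clamp b - clamp a <= b - a.
  by move=> ab; apply/andP; split; case: (cP a) => -[? ->]; case: (cP b) => -[? ->]; lra.
wlog xy : x y / x <= y.
  by move=> H; have [/H//|/ltW/H] := leP x y; rewrite distrC (distrC y).
have /andP[h1 h2] := mono _ _ xy.
by rewrite distrC (distrC x) !ger0_norm// subr_ge0.
Qed.

Lemma continuous_clamp : continuous clamp.
Proof.
move=> x; apply/cvgrPdist_le => e e0.
have /cvgrPdist_le/(_ e e0) : (fun y : R => y) @ x --> x by exact: cvg_id.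
by apply: filterS => y; apply: le_trans; exact: clamp_lipschitz.
Qed.

(** Trades the subspace topology of [0,1] for ordinary continuity on the line. *)
Lemma continuous_comp_clamp (f : R -> R) : C01 f <-> continuous (f \o clamp).
Proof.
split=> [/subspace_continuousP cf x|cf].
  apply/cvgrPdist_le => e e0.
  have /cvgrPdist_le/(_ e e0) H := cf _ (clamp_I01 x).
  have {}H : \forall z \near clamp x, I01 z -> `|f (clamp x) - f z| <= e := H.
  have := @continuous_clamp x _ H; apply: (@filterS _ (nbhs x)) => y /= /(_ (clamp_I01 y)).
  exact.
apply/subspace_continuousP => x xI.
apply/cvgrPdist_le => e e0; have /cvgrPdist_le/(_ e e0) := cf x.
by apply: filterS => y /=; rewrite clamp_id// => + yI; rewrite clamp_id.
Qed.

Lemma continuous_bmeas_clamp (f : R -> R) : continuous f -> bmeas (f \o clamp).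
Proof.
move=> cf; have cfc : continuous (f \o clamp).
  by move=> x; apply: continuous_comp; [exact: continuous_clamp|exact: cf].
split; first by apply: continuous_measurable_fun; exact: cfc.
have : compact (f @` (@I01 R)).
  apply: continuous_compact; first by apply: continuous_subspaceT; exact: cf.
  exact: (@segment_compact R 0 1).
move=> /compact_bounded[N [_ HN]].
exists (N + 1) => x; apply: (HN (N + 1)); first by rewrite ltrDl.
by exists (clamp x) => //; exact: clamp_I01.
Qed.

End Clamp.

(** * Continuity of images of bounded measurable functions *)

Lemma ler_dist_add3 (R : numDomainType) (x y x' y' e1 e2 e3 : R) :
  `|x - x'| <= e1 -> `|x' - y'| <= e2 -> `|y - y'| <= e3 ->
  `|x - y| <= e1 + e2 + e3.
Proof.
move=> h1 h2 h3; apply: le_trans (ler_distD y' _ _) _.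
apply: lerD; last by rewrite distrC.
by apply: le_trans (ler_distD x' _ _) _; exact: lerD.
Qed.

Section ContinuousKernel.
Variables (R : realType) (k : R -> R -> R -> R) (m M : R).
Hypotheses (m0 : 0 < m) (mk : forall t s u, m <= k t s u)
  (kM : forall t s u, k t s u <= M)
  (meask : forall t, measurable_fun setT (fun p : R * R => k t p.1 p.2)).
Hypothesis cont_lyapunov :
  forall f, continuous f -> continuous (lyapunov k f).

Lemma L1_dense_continuous (g : R -> R) e : bmeas g -> 0 < e ->
  exists h : R -> R, [/\ continuous h, bmeas h &
    int01 (fun s => `|g s - h s|) <= e].
Proof.
move=> bg e0.
have mu_fin : (@lebesgue_measure R (@I01 R) < +oo)%E.
  by rewrite [X in (X < _)%E]lebesgue_I01 ltry.
have [h_ [ch _]] := @approximation_continuous_integrable R I01 g (@measurable_I01 R)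
  mu_fin (bmeas_integrable bg).
move=> /fine_fcvg/cvgr0Pnorm_le/(_ e e0)[n _ /(_ n (leqnn n))/= Hn].
(* The approximant may be unbounded on the line; clamping bounds it and leaves it unchanged on
   [0,1]. *)
exists (h_ n \o @clamp R); split.
- by move=> x; apply: continuous_comp; [exact: continuous_clamp|exact: ch].
- exact: continuous_bmeas_clamp.
rewrite (@eq_int01 _ _ (fun s => `|g s - h_ n s|)); last first.
  by move=> x xI /=; rewrite clamp_id.
by apply: le_trans Hn; apply: ler_norm.
Qed.

(** L1 approximation of [g] by continuous functions becomes uniform approximation of its image, and
    uniform limits of continuous functions are continuous. *)
Lemma continuous_lyapunov_bmeas g : bmeas g -> continuous (lyapunov k g).
Proof.
move=> bg t; apply/cvgrPdist_le => e e0.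
pose A := int01 (fun s => `|g s|).
have A0 : 0 <= A by apply: int01_ge0.
have M0 : 0 <= M by exact: (M_ge0 m0 mk kM).
(* [D] dominates the Lipschitz factor, because [d <= 1] keeps the L1 norm of [h] below [A + 1]; the
   last 1 makes [D] positive. *)
pose D := M * (A + (A + 1)) + 1.
have D0 : 0 < D by rewrite ltr_wpDl// mulr_ge0// !addr_ge0.
pose d := Num.min 1 (e / 3 / D).
have d0 : 0 < d by rewrite lt_min ltr01 !divr_gt0.
have [h [ch bh hd]] := L1_dense_continuous bg d0.
have close x : `|lyapunov k g x - lyapunov k h x| <= e / 3.
  rewrite (le_trans (lyapunov_lipschitz m0 mk kM meask x bg bh))//.
  have hA : int01 (fun s => `|h s|) <= A + 1.
    rewrite -lerBlDl.
    have bgn := bmeas_norm bg; have bhn := bmeas_norm bh.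
    rewrite -int01B// (@le_trans _ _ d)//; last by rewrite ge_min lexx.
    apply: le_trans hd; apply: le_int01; first exact: bmeasB.
      exact/bmeas_norm/bmeasB.
    by move=> s _; rewrite (distrC (g s)); exact: lerB_dist.
  rewrite (@le_trans _ _ (D * d))//.
    apply: ler_pM => //.
    - by rewrite mulr_ge0// addr_ge0//; apply: int01_ge0.
    - by apply: int01_ge0.
    rewrite /D (@le_trans _ _ (M * (A + (A + 1))))// ?lerDl//.
    by rewrite ler_wpM2l// lerD2l.
  by rewrite mulrC -ler_pdivlMr// ge_min lexx orbT.
have e30 : 0 < e / 3 by rewrite divr_gt0.
have := ch; move=> /cont_lyapunov/(_ t)/cvgrPdist_le/(_ _ e30).
apply: filterS => x hx.
rewrite (_ : e = e / 3 + e / 3 + e / 3); last by field.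
exact: (ler_dist_add3 (close t) hx (close x)).
Qed.

Lemma bmeas_lyapunov g : bmeas g -> bmeas (lyapunov k g).
Proof.
move=> bg; split.
  by apply: continuous_measurable_fun; exact: continuous_lyapunov_bmeas.
exists (M * int01 (fun s => `|g s|) * int01 (fun s => `|g s|)).
exact: (lyapunov_bounded m0 mk kM meask bg).
Qed.
End ContinuousKernel.

(** * Step functions and approximate fixed points *)

Section StepFunctions.
Variables (R : realType) (n : nat).
Let N : R := n.+1%:R.
Let N_gt0 : 0 < N. Proof. by rewrite ltr0n. Qed.

(** Half-open intervals are pairwise disjoint but miss the point 1, whence the null correction at 1
    in [sum_cell]. *)
Definition cell (i : 'I_n.+1) : set R := `[i%:R / N, i.+1%:R / N[%classic.

Lemma cellE i x : 0 <= x -> cell i x <-> Num.truncn (x * N) = i.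
Proof.
move=> x0; rewrite /cell/= in_itv/= ler_pdivrMr// ltr_pdivlMr//; split.
  exact: truncn_def.
by move=> <-; apply: truncn_itv; apply: mulr_ge0 => //; exact: ltW.
Qed.

Lemma measurable_cell i : measurable (cell i).
Proof. exact: measurable_itv. Qed.
Hint Resolve measurable_cell : core.

Lemma cell_I01 i : cell i `<=` I01.
Proof.
move=> x; rewrite /cell/I01/= !in_itv/= => /andP[xi xi1].
rewrite (le_trans _ xi) ?divr_ge0//= (le_trans (ltW xi1))//.
by rewrite ler_pdivrMr// mul1r ler_nat.
Qed.

Lemma bmeas_cell i : bmeas (\1_(cell i) : R -> R).
Proof. exact: bmeas_indic. Qed.
Hint Resolve bmeas_cell : core.

Lemma int01_cell i : int01 (\1_(cell i)) = N^-1.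
Proof.
rewrite int01_indic//; last exact: cell_I01.
rewrite /cell lebesgue_measure_itv/= lte_fin ltr_pM2r ?invr_gt0// ltr_nat ltnSn.
by rewrite /= -mulrBl -natrB// subSnn mul1r.
Qed.

Lemma sum_cell x : I01 x -> \sum_i \1_(cell i) x = 1 - \1_[set 1] x :> R.
Proof.
rewrite /I01/= in_itv/= => /andP[x0 x1].
have [->|xn1] := eqVneq x 1.
  rewrite indicE mem_set// subrr big1// => i _.
  rewrite indicE memNset// => /cellE; rewrite ler01 mul1r => /(_ isT).
  by rewrite /N natrK => ni; have := ltn_ord i; rewrite -ni ltnn.
have ltN : (Num.truncn (x * N) < n.+1)%N.
  rewrite -(ltr_nat R) (le_lt_trans (_ : _ <= x * N))//.
    by rewrite truncn_le// mulr_ge0// ltW.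
  by rewrite -/N gtr_pMl// lt_neqAle xn1.
rewrite [in RHS]indicE memNset; last by move=> /eqP; apply/negP.
rewrite subr0 (bigD1 (Ordinal ltN))//= big1 => [|i ine].
  by rewrite addr0 indicE mem_set//; apply/cellE.
rewrite indicE memNset// => /cellE => /(_ x0) xi; move/eqP: ine; apply.
exact/val_inj.
Qed.

Lemma int01_set1 f : bmeas f -> int01 (fun x => \1_[set 1] x * f x) = 0 :> R.
Proof.
move=> bf; have [B fB] := bf.2.
have b1 : bmeas (\1_[set 1] : R -> R) by apply: bmeas_indic; exact: measurable_set1.
apply/eqP; rewrite -normr_le0 (le_trans (norm_int01 (bmeasM b1 bf)))//.
rewrite (@le_trans _ _ (int01 (fun x => B * \1_[set 1] x)))//.
  apply: le_int01; [exact/bmeas_norm/bmeasM|exact: bmeasM|].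
  move=> x _; rewrite normrM mulrC.
  by rewrite [X in _ * X](ger0_norm (_ : 0 <= \1_[set 1] x))// ler_wpM2r.
rewrite int01Z// int01_indic; [|exact: measurable_set1|].
  by rewrite lebesgue_measure_set1 mulr0.
by move=> _ ->; rewrite /I01/= in_itv/= ler01 lexx.
Qed.

Lemma int01_cells f : bmeas f ->
  \sum_i int01 (fun x => \1_(cell i) x * f x) = int01 f.
Proof.
move=> bf; rewrite -int01_sum; last by move=> i; exact: bmeasM.
have b1 : bmeas (\1_[set 1] : R -> R) by apply: bmeas_indic; exact: measurable_set1.
rewrite (@eq_int01 _ _ (fun x => f x - \1_[set 1] x * f x)); last first.
  by move=> x xI; rewrite -mulr_suml sum_cell//; ring.
by rewrite int01B//; [rewrite int01_set1// subr0|exact: bmeasM].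
Qed.

(** The parameter [a i] is the mass of a cell, not the height over it, so that points of the simplex
    correspond to probability densities. *)
Definition step (a : 'I_n.+1 -> R) x := \sum_i N * a i * \1_(cell i) x.

Lemma bmeas_step a : bmeas (step a).
Proof. by apply: bmeas_sum => i; exact: bmeasM. Qed.
Hint Resolve bmeas_step : core.

Lemma step_cell a i x : cell i x -> step a x = N * a i.
Proof.
move=> ix; have x0 : 0 <= x.
  by have := cell_I01 ix; rewrite /I01/= in_itv/= => /andP[].
rewrite /step (bigD1 i)//= indicE mem_set// mulr1 big1 ?addr0// => j ji.
rewrite indicE memNset ?mulr0// => /cellE => /(_ x0) xj.
by move/cellE : ix => /(_ x0); rewrite xj => /val_inj/eqP; apply/negP.
Qed.

Lemma step_outside a x : (forall i, ~ cell i x) -> step a x = 0.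
Proof. by move=> H; apply: big1 => i _; rewrite indicE memNset ?mulr0. Qed.

Lemma step_ind (P : R -> Prop) a x : P 0 -> (forall i, P (N * a i)) -> P (step a x).
Proof.
move=> P0 PN; have [[i ix]|H] := pselect (exists i, cell i x).
  by rewrite (step_cell _ ix).
by rewrite step_outside// => i ix; apply: H; exists i.
Qed.

Lemma int01_step_cell a i : int01 (fun x => \1_(cell i) x * step a x) = a i.
Proof.
rewrite (@eq_int01 _ _ (fun x => N * a i * \1_(cell i) x)); last first.
  move=> x _; rewrite indicE; have [/set_mem ix|_] := boolP (x \in cell i).
    by rewrite (step_cell _ ix) mul1r mulr1.
  by rewrite mul0r mulr0.
by rewrite int01Z// int01_cell mulrAC divff ?mul1r// gt_eqF.
Qed.

Lemma int01_step a : int01 (step a) = \sum_i a i.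
Proof. by rewrite -int01_cells//; apply: eq_bigr => i _; exact: int01_step_cell. Qed.

Lemma stepB a b x : step a x - step b x = step (fun i => a i - b i) x.
Proof. by rewrite -sumrB; apply: eq_bigr => i _; ring. Qed.

(* a cell lying to the left of [x] contributes its full integral, a cell to the
   right contributes nothing, and at most one cell contains [x] in its interior *)
Lemma int01_ray_cells (d : R -> R) (B e : R) x : bmeas d -> 0 <= e ->
  (forall x, `|d x| <= B) ->
  (forall i, `|int01 (fun s => \1_(cell i) s * d s)| <= e) ->
  `|int01 (fun s => \1_(`]-oo, x[%classic : set R) s * d s)| <= N * e + B / N.
Proof.
move=> bd e0 dB de.
have B0 : 0 <= B by exact: le_trans (dB 0).
have br : bmeas (\1_(`]-oo, x[%classic : set R) : R -> R) by exact: bmeas_indic.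
have bc i : bmeas (fun s => \1_(cell i) s * (\1_(`]-oo, x[%classic : set R) s * d s)).
  by apply: bmeasM => //; exact: bmeasM.
rewrite -int01_cells; last exact: bmeasM.
pose P := [pred i : 'I_n.+1 | i%:R / N < x < i.+1%:R / N].
have term i : `|int01 (fun s => \1_(cell i) s * (\1_(`]-oo, x[%classic : set R) s * d s))|
    <= e + (if P i then B / N else 0).
  have [Pi|] := boolP (P i).
    apply: ler_wpDl => //; rewrite (le_trans (norm_int01 (bc i)))//.
    rewrite -(int01_cell i) -int01Z//; apply: le_int01.
    - exact: bmeas_norm.
    - exact: bmeasM.
    move=> s _; rewrite !normrM mulrC ler_pM//.
      rewrite -[leRHS]mul1r ler_pM//; rewrite indicE.
      by case: (_ \in _); rewrite ?normr1 ?normr0.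
    by rewrite ger0_norm.
  rewrite addr0 inE negb_and -!leNgt => /orP[xi|ix].
    rewrite (@eq_int01 _ _ (fun=> 0)) ?int01_cst ?normr0// => s _.
    rewrite !indicE; have [/set_mem|_] := boolP (s \in cell i); last by rewrite mul0r.
    rewrite /cell/= in_itv/= => /andP[ls _]; rewrite memNset ?mul0r ?mulr0//=.
    by rewrite in_itv/= ltNge (le_trans xi).
  rewrite (@eq_int01 _ _ (fun s => \1_(cell i) s * d s))// => s _.
  rewrite !indicE; have [/set_mem|_] := boolP (s \in cell i); last by rewrite !mul0r.
  rewrite /cell/= in_itv/= => /andP[_ si]; rewrite mem_set ?mul1r//=.
  by rewrite in_itv/= (lt_le_trans si).
rewrite (le_trans (ler_norm_sum _ _ _))// (le_trans (ler_sum _ (fun i _ => term i)))//.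
rewrite big_split/= sumr_const card_ord -mulr_natl -/N lerD2l.
rewrite -big_mkcond/= sumr_const.
have : (#|P| <= 1)%N.
  apply/card_le1_eqP => i j; rewrite !inE => /andP[i1 i2] /andP[j1 j2].
  have lt (u v : 'I_n.+1) : u%:R / N < x -> x < v.+1%:R / N -> (u <= v)%N.
    move=> h1 h2; have := lt_trans h1 h2.
    by rewrite ltr_pM2r ?invr_gt0// ltr_nat ltnS.
  by apply/val_inj/eqP; rewrite eqn_leq !lt.
by case: #|P| => [|[|//]] _; rewrite ?mulr0n ?mulr1n// divr_ge0// ltW.
Qed.

End StepFunctions.

(** * Galerkin approximation of the normalized operator *)

Lemma ratio_lipschitz (R : realFieldType) (a b c c' m M e : R) :
  0 < m -> m <= c -> m <= c' -> 0 <= b -> b <= M ->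
  `|a - b| <= e -> `|c' - c| <= e ->
  `|a / c - b / c'| <= e / m + M * e / (m * m).
Proof.
move=> m0 cm cm' b0 bM abe ce.
have c0 : 0 < c by exact: lt_le_trans cm.
have c0' : 0 < c' by exact: lt_le_trans cm'.
have -> : a / c - b / c' = (a - b) / c + b * (c' - c) / (c * c').
  by field; rewrite !gt_eqF.
apply: le_trans (ler_normD _ _) _; apply: lerD.
  rewrite normrM normfV (gtr0_norm c0); apply: ler_pM => //.
  - by rewrite invr_ge0 ltW.
  - by rewrite lef_pV2 ?posrE.
rewrite !normrM normfV normrM (gtr0_norm c0) (gtr0_norm c0') (ger0_norm b0).
apply: ler_pM.
- by rewrite mulr_ge0.
- by rewrite invr_ge0 mulr_ge0// ltW.
- exact: ler_pM.
- by rewrite lef_pV2 ?posrE ?mulr_gt0//; apply: ler_pM => //; exact: ltW.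
Qed.

Section Galerkin.
Variables (R : realType) (k : R -> R -> R -> R) (m M : R).
Hypotheses (m0 : 0 < m) (mk : forall t s u, m <= k t s u)
  (kM : forall t s u, k t s u <= M)
  (meask : forall t, measurable_fun setT (fun p : R * R => k t p.1 p.2)).
Hypothesis cont_lyapunov :
  forall f, continuous f -> continuous (lyapunov k f).

Definition density (g : R -> R) :=
  [/\ bmeas g, forall x, 0 <= g x & int01 g = 1].

Definition normalized g t := lyapunov k g t / int01 (lyapunov k g).

Let M0 : 0 < M. Proof. exact: lt_le_trans m0 (le_trans (mk 0 0 0) (kM 0 0 0)). Qed.

Let bL g : bmeas g -> bmeas (lyapunov k g).
Proof. exact: (bmeas_lyapunov m0 mk kM meask cont_lyapunov). Qed.

Let L_bounds g t : density g -> m <= lyapunov k g t <= M.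
Proof. by move=> [bg g0 g1]; exact: (lyapunov_bounds m0 mk kM meask). Qed.

Lemma mass_bounds g : density g -> m <= int01 (lyapunov k g) <= M.
Proof.
move=> dg; have [bg _ _] := dg; have bLg := bL bg; apply/andP; split.
  by rewrite -[leLHS]int01_cst; apply: le_int01 => // x _; case/andP: (L_bounds x dg).
by rewrite -[leRHS]int01_cst; apply: le_int01 => // x _; case/andP: (L_bounds x dg).
Qed.

Lemma mass_gt0 g : density g -> 0 < int01 (lyapunov k g).
Proof. by move=> /mass_bounds/andP[+ _]; exact: lt_le_trans. Qed.

Lemma bmeas_normalized g : bmeas g -> bmeas (normalized g).
Proof. by move=> bg; apply: bmeasM; first exact: bL. Qed.

Lemma normalized_bounds g t : density g -> m / M <= normalized g t <= M / m.
Proof.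
move=> dg; have c0 := mass_gt0 dg.
have /andP[cm cM] := mass_bounds dg; have /andP[Lm LM] := L_bounds t dg.
have m0' := ltW m0.
rewrite /normalized.
move: (int01 _) c0 cm cM (lyapunov k g t) Lm LM => c c0 cm cM L Lm LM.
apply/andP; split; apply: ler_pM => //.
- by rewrite invr_ge0 ltW.
- by rewrite lef_pV2 ?posrE.
- exact: le_trans Lm.
- by rewrite invr_ge0 ltW.
- by rewrite lef_pV2 ?posrE.
Qed.

Lemma normalized_gt0 g t : density g -> 0 < normalized g t.
Proof. by move=> /(normalized_bounds t)/andP[+ _]; apply: lt_le_trans; rewrite divr_gt0. Qed.

Lemma density_normalized g : density g -> density (normalized g).
Proof.
move=> dg; split; first by case: dg => bg _ _; exact: bmeas_normalized.
  by move=> x; exact/ltW/normalized_gt0.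
rewrite /normalized (@eq_int01 _ _ (fun t => (int01 (lyapunov k g))^-1 * lyapunov k g t)).
  by rewrite int01Z ?mulVf ?gt_eqF ?mass_gt0//; case: dg => bg _ _; exact: bL.
by move=> x _; rewrite mulrC.
Qed.

Lemma normalized_lipschitz f g t : density f -> density g ->
  `|normalized f t - normalized g t| <=
  (2 * M / m + 2 * M * M / (m * m)) * int01 (fun s => `|f s - g s|).
Proof.
move=> df dg.
have [bf f0 f1] := df; have [bg g0 g1] := dg.
have cf0 := mass_gt0 df; have cg0 := mass_gt0 dg.
have /andP[cfm _] := mass_bounds df; have /andP[cgm _] := mass_bounds dg.
have /andP[_ LgM] := L_bounds t dg; have /andP[/(le_trans (ltW m0)) Lg0 _] := L_bounds t dg.
set D := int01 (fun s => `|f s - g s|).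
have D0 : 0 <= D by apply: int01_ge0.
have Llip x : `|lyapunov k f x - lyapunov k g x| <= 2 * M * D.
  rewrite (le_trans (lyapunov_lipschitz m0 mk kM meask x bf bg))//.
  rewrite (@eq_int01 _ (fun s => `|f s|) f) ?f1; last by move=> *; rewrite ger0_norm.
  rewrite (@eq_int01 _ (fun s => `|g s|) g) ?g1; last by move=> *; rewrite ger0_norm.
  by rewrite [M * _]mulrC.
have clip : `|int01 (lyapunov k g) - int01 (lyapunov k f)| <= 2 * M * D.
  rewrite -int01B; [|exact: bL..]; apply: int01_bound; first by apply: bmeasB; exact: bL.
  by move=> x _; rewrite distrC.
have -> : (2 * M / m + 2 * M * M / (m * m)) * D =
    2 * M * D / m + M * (2 * M * D) / (m * m) by ring.
exact: (ratio_lipschitz m0 cfm cgm Lg0 LgM (Llip t) clip).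
Qed.

(** The cell masses of the normalized image define a self-map of the simplex, and an approximate
    fixed point of it gives the step function. Agreement is measured on rays, the test functions
    that generate weak convergence. *)
Lemma galerkin n : exists g, [/\ density g, forall x, g x <= M / m + 1 &
  forall x, `|int01 (fun s => \1_(`]-oo, x[%classic : set R) s * (g s - normalized g s))|
    <= (M / m + 2) / n.+1%:R].
Proof.
pose N : R := n.+1%:R; have N0 : 0 < N by rewrite ltr0n.
have N1 : 1 <= N by rewrite ler1n.
pose S := 2 * M / m + 2 * M * M / (m * m).
have S0 : 0 < S by rewrite addr_gt0// !divr_gt0// !mulr_gt0.
have dstep a : @simplex R n a -> density (step a).
  move=> [a0 a1]; split; first exact: bmeas_step.
    move=> x; apply: (step_ind (P := fun z => 0 <= z)) => // i.
    by apply: mulr_ge0 => //; exact: ltW.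
  by rewrite int01_step.
pose T (a : 'I_n.+1 -> R) i :=
  int01 (fun x => \1_(@cell R n i) x * normalized (step a) x).
have bT a i : bmeas (fun x => \1_(@cell R n i) x * normalized (step a) x).
  by apply: bmeasM; [exact: bmeas_cell|exact/bmeas_normalized/bmeas_step].
have Tsimp a : simplex a -> simplex (T a).
  move=> /dstep/density_normalized[bg g0 g1]; split.
    by move=> i; apply: int01_ge0 => x _; rewrite mulr_ge0.
  by rewrite int01_cells.
(* An error [1 / N ^ 2] on each of [N] cells sums to [1 / N]; the cell cut by the ray adds
   [(M / m + 1) / N], whence the constant [M / m + 2]. *)
have [||a sa Ha] := @approx_fixpoint R n T Tsimp _ (N^-1 * N^-1).
(* Heights are [N] times masses, so this makes the step functions [e / S] close, and [S] is the
   Lipschitz constant of [normalized]. *)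
- move=> e e0; exists (e / (S * N)); first by rewrite divr_gt0// mulr_gt0.
  move=> a b sa sb ab i.
  have da := dstep _ sa; have db := dstep _ sb.
  rewrite /T -int01B; [|exact: bT..].
  have bd : bmeas (fun s => step a s - step b s).
    by apply: bmeasB; exact: bmeas_step.
  apply: int01_bound; first by apply: bmeasB; exact: bT.
  move=> x _; rewrite -mulrBr normrM.
  rewrite (@le_trans _ _ (`|normalized (step a) x - normalized (step b) x|))//.
    by rewrite ler_piMl// indicE; case: (_ \in _); rewrite ?normr1 ?normr0.
  rewrite (le_trans (normalized_lipschitz x da db))// -/S mulrC -ler_pdivlMr//.
  rewrite -[leRHS]int01_cst; apply: le_int01 => //; first exact: bmeas_norm.
  move=> s _; rewrite stepB; apply: (step_ind (P := fun z => `|z| <= e / S)).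
    by rewrite normr0 divr_ge0// ltW.
  move=> j; rewrite normrM gtr0_norm// mulrC -ler_pdivlMr//.
  by rewrite (le_trans (ab j))// invfM mulrA.
- by rewrite mulr_gt0// invr_gt0.
have [bg g0 g1] := dstep _ sa.
have dg := dstep _ sa.
have Mm0 : 0 < M / m by rewrite divr_gt0.
have gB x : step a x <= M / m + 1.
  apply: (step_ind (P := fun z => z <= M / m + 1)) => [|i]; first by rewrite addr_ge0// ltW.
  have := Ha i; rewrite ler_norml => /andP[h _].
  have Ti : T a i <= M / m * N^-1.
    rewrite -(int01_cell R i) -int01Z; last exact: bmeas_cell.
    apply: le_int01; [exact: bT|by apply: bmeasM => //; exact: bmeas_cell|].
    move=> y _; rewrite mulrC ler_wpM2r//.
    by have /andP[] := normalized_bounds y dg.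
  rewrite mulrC -ler_pdivlMr//.
  have : N^-1 * N^-1 <= N^-1 by rewrite ger_pMl ?invr_gt0// invf_le1.
  rewrite mulrDl mul1r => NN; apply: le_trans (lerD Ti NN).
  by move: h; rewrite lerBrDr addrC lerBlDr.
exists (step a); split=> // x.
have bd : bmeas (fun s => step a s - normalized (step a) s).
  by apply: bmeasB => //; exact: bmeas_normalized.
have := @int01_ray_cells R n (fun s => step a s - normalized (step a) s)
   (M / m + 1) (N^-1 * N^-1) x bd.
move=> /(_ _ _ _)/le_trans; apply.
- by rewrite mulr_ge0// invr_ge0 ltW.
- move=> s; have := gB s; have := g0 s; have := normalized_gt0 s dg.
  have /andP[_] := normalized_bounds s dg.
  by rewrite ler_norml => *; apply/andP; split; lra.
- move=> i; rewrite (@eq_int01 _ _ (fun s => \1_(cell i) s * step a s -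
     \1_(cell i) s * normalized (step a) s)); last by move=> *; rewrite mulrBr.
  rewrite int01B; [|by apply: bmeasM => //; exact: bmeas_cell|exact: bT].
  by rewrite int01_step_cell distrC; exact: Ha.
rewrite -/N mulrA divff ?gt_eqF// mul1r -[X in X + _]mul1r -mulrDl.
by rewrite (_ : 1 + _ = M / m + 2)//; ring.
Qed.

End Galerkin.

(** * Passage to the limit *)

Section Eigenfunction.
Variables (R : realType) (k : R -> R -> R -> R) (m M : R).
Hypotheses (m0 : 0 < m) (mk : forall t s u, m <= k t s u)
  (kM : forall t s u, k t s u <= M)
  (meask : forall t, measurable_fun setT (fun p : R * R => k t p.1 p.2)).
Hypothesis cont_lyapunov :
  forall f, continuous f -> continuous (lyapunov k f).

Let ray (x : R) : R -> R := \1_(`]-oo, x[%classic : set R).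

Let bray x : bmeas (ray x). Proof. exact: bmeas_indic. Qed.

(** Provides the equicontinuity of distribution functions that [pointwise_cvg_subsequence]
    requires. *)
Lemma int01_ray_lipschitz (g : R -> R) (B : R) x y : bmeas g ->
  (forall s, `|g s| <= B) ->
  `|int01 (fun s => ray x s * g s) - int01 (fun s => ray y s * g s)| <=
  B * `|x - y|.
Proof.
move=> bg gB; wlog xy : x y / x <= y.
  by move=> H; have [/H//|/ltW/H] := leP x y; rewrite distrC (distrC y).
have B0 : 0 <= B by exact: le_trans (gB 0).
have mxy : measurable (`[x, y[%classic : set R) by exact: measurable_itv.
have E s : ray y s - ray x s = \1_(`[x, y[%classic : set R) s.
  rewrite /ray !indicE !mem_setE !in_itv/=.
  case: (ltP s x) => sx; case: (ltP s y) => sy //=; rewrite ?subrr ?subr0//.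
  by have := le_lt_trans (le_trans xy sy) sx; rewrite ltxx.
rewrite distrC -int01B; [|exact: bmeasM..].
rewrite (@eq_int01 _ _ (fun s => \1_(`[x, y[%classic : set R) s * g s)); last first.
  by move=> s _; rewrite -mulrBl E.
have bxy : bmeas (\1_(`[x, y[%classic : set R) : R -> R) by exact: bmeas_indic.
rewrite (le_trans (norm_int01 (bmeasM bxy bg)))//.
rewrite (@le_trans _ _ (int01 (fun s => B * \1_(`[x, y[%classic : set R) s)))//.
  apply: le_int01; [exact/bmeas_norm/bmeasM|exact: bmeasM|].
  by move=> s _; rewrite normrM mulrC [X in _ * X]ger0_norm// ler_wpM2r.
rewrite int01Z// ler_wpM2l// distrC ger0_norm ?subr_ge0//.
rewrite /int01 /Rintegral integral_indic//; last exact: measurable_I01.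
rewrite -[leRHS]/(fine (y - x)%:E); have muxy : lebesgue_measure (`[x, y[%classic : set R) = (y - x)%:E.
  rewrite lebesgue_measure_itv/= lte_fin; case: ltP => // yx.
  by rewrite (@le_anti _ _ x y) ?subrr// xy.
have le_mu : (lebesgue_measure ((`[x, y[%classic : set R) `&` I01) <= (y - x)%:E)%E.
  by rewrite -muxy; apply: le_measure; rewrite ?inE;
    [by apply: measurableI; [exact: mxy|exact: measurable_I01]|exact: mxy|exact: subIsetl].
apply: fine_le; [|by []|exact: le_mu].
by rewrite ge0_fin_numE ?measure_ge0//; exact: le_lt_trans le_mu (ltry _).
Qed.

(** The differences [h_ p.1 - h_ p.2] are weakly null on rays along the product filter, hence on all
    bounded measurable functions, which is the Cauchy property. No function representing the limit
    is constructed. *)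
Lemma weak_limit_exists (h_ : nat -> R -> R) (B : R) :
  (forall n, bmeas (h_ n)) -> (forall n x, `|h_ n x| <= B) ->
  (forall x, cvgn (fun n => int01 (fun s => ray x s * h_ n s))) ->
  forall psi, bmeas psi -> cvgn (fun n => int01 (fun s => psi s * h_ n s)).
Proof.
move=> bh hB hcv psi bpsi.
pose d (p : nat * nat) s := h_ p.1 s - h_ p.2 s.
have Bd p s : `|d p s| <= B + B by rewrite (le_trans (ler_normB _ _))// lerD.
have md p : measurable_fun setT (d p) by case: (bmeasB (bh p.1) (bh p.2)).
have E phi : bmeas phi -> (fun p => int01 (fun s => phi s * d p s)) =
    (fun p => int01 (fun s => phi s * h_ p.1 s) - int01 (fun s => phi s * h_ p.2 s)).
  move=> bphi; apply/funext => p; rewrite -int01B; [|exact: bmeasM..].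
  by apply: eq_int01 => s _; rewrite mulrBr.
have rays x : weakly_null (filter_prod \oo \oo) d (ray x).
  rewrite /weakly_null E//.
  rewrite -(subrr (limn (fun n => int01 (fun s => ray x s * h_ n s)))).
  apply: cvgB; apply: cvg_comp (hcv x); [exact: cvg_fst|exact: cvg_snd].
have psi0 : weakly_null (filter_prod \oo \oo) d psi.
  exact: (weakly_null_bmeas md Bd rays bpsi).
rewrite /weakly_null E// in psi0.
apply/cauchy_cvgP/cauchy_exP => e e0.
move/cvgr0Pnorm_lt : psi0 => /(_ e e0)[[P Q] [/= [N _ NP] [N' _ NQ]] PQ].
exists (int01 (fun s => psi s * h_ N s)); exists N' => // n /= N'n.
by have := PQ (N, n); apply; split; [exact: (NP _ (leqnn N))|exact: NQ].
Qed.

Theorem eigenfunction : exists f c, [/\ bmeas f, forall x, 0 < f x, 0 < c &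
  forall t, lyapunov k f t = c * f t].
Proof.
have M0 : 0 < M by exact: lt_le_trans m0 (le_trans (mk 0 0 0) (kM 0 0 0)).
have [g_ Hg] := choice (galerkin m0 mk kM meask cont_lyapunov).
pose B := M / m + 1.
have B0 : 0 <= B by rewrite addr_ge0// divr_ge0// ltW.
have gB n x : `|g_ n x| <= B.
  by have [[_ g0 _] gB _] := Hg n; rewrite ger0_norm.
have bg n : bmeas (g_ n) by have [[]] := Hg n.
have [||phi phin Hphi] := @pointwise_cvg_subsequence R
  (fun n x => int01 (fun s => ray x s * g_ n s)) B B.
- move=> n x; apply: int01_bound; first exact: bmeasM.
  move=> s _; rewrite normrM -[leRHS]mul1r ler_pM// /ray indicE.
  by case: (_ \in _); rewrite ?normr1 ?normr0.
- by move=> n x y; exact: int01_ray_lipschitz.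
pose h_ n := g_ (phi n).
have dh n : density (h_ n) by have [] := Hg (phi n).
have bh n : bmeas (h_ n) by exact: bg.
have hB n x : `|h_ n x| <= B by exact: gB.
have weak := weak_limit_exists bh hB Hphi.
(* The images converge pointwise although the weak limit of [h_] is not yet known to be a function;
   their limit [A] will provide that function. *)
pose A t := limn (fun n => lyapunov k (h_ n) t).
have LA t : lyapunov k (h_ n) t @[n --> \oo] --> A t.
  suff : cvgn (fun n => lyapunov k (h_ n) t) by [].
  apply/cvg_ex; eexists.
  exact: (lyapunov_cvg m0 mk kM meask bh hB weak).
have L_bounds n t : m <= lyapunov k (h_ n) t <= M.
  by have [b1 b2 b3] := dh n; exact: (lyapunov_bounds m0 mk kM meask).
have normL n t : `|lyapunov k (h_ n) t| <= M.
  have /andP[h1 h2] := L_bounds n t.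
  by rewrite ger0_norm// (le_trans (ltW m0)).
have A_bounds t : m <= A t <= M.
  have cA : cvgn (fun n => lyapunov k (h_ n) t) by apply/cvg_ex; exists (A t); exact: LA.
  apply/andP; split.
    by apply: limr_ge => //; apply: nearW => n; case/andP: (L_bounds n t).
  by apply: limr_le => //; apply: nearW => n; case/andP: (L_bounds n t).
have bL n : bmeas (lyapunov k (h_ n)).
  exact: (bmeas_lyapunov m0 mk kM meask cont_lyapunov).
have bA : bmeas A.
  split.
    apply: (@measurable_fun_cvg _ _ _ _ (fun n => lyapunov k (h_ n))) => //.
    by move=> n; case: (bL n).
  exists M => t; have /andP[h1 h2] := A_bounds t.
  by rewrite ger0_norm// (le_trans (ltW m0)).
pose c := int01 A.
have cc : int01 (lyapunov k (h_ n)) @[n --> \oo] --> c by exact: (int01_cvg bL bA).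
have c0 : 0 < c.
  rewrite (lt_le_trans m0)// -[leLHS]int01_cst; apply: le_int01 => // t _.
  by case/andP: (A_bounds t).
pose f t := A t / c.
have bf : bmeas f by exact: bmeasM.
have f0 t : 0 < f t by rewrite divr_gt0//; case/andP: (A_bounds t) => /(lt_le_trans m0).
have nf t : normalized k (h_ n) t @[n --> \oo] --> f t.
  by apply: cvgM; [exact: LA|apply: cvgV => //; rewrite gt_eqF].
have nB n t : `|normalized k (h_ n) t| <= M / m.
  have n0 := normalized_gt0 m0 mk kM meask cont_lyapunov t (dh n).
  rewrite gtr0_norm//.
  by have /andP[] := normalized_bounds m0 mk kM meask cont_lyapunov t (dh n).
have bn n : bmeas (normalized k (h_ n)).
  exact: (bmeas_normalized m0 mk kM meask cont_lyapunov).
have [Bf fB] := bf.2.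
pose d n s := h_ n s - f s.
have bd n : bmeas (d n) by exact: bmeasB.
have dB n s : `|d n s| <= B + Bf by rewrite (le_trans (ler_normB _ _))// lerD.
(* [h_ n - f] is split through [normalized k (h_ n)]: the first part is small by [galerkin], the
   second tends to 0 by dominated convergence. Thus [f] is the weak limit of [h_]. *)
have drays x : weakly_null \oo d (ray x).
  rewrite /weakly_null.
  have -> : (fun n => int01 (fun s => ray x s * d n s)) =
      (fun n => int01 (fun s => ray x s * (h_ n s - normalized k (h_ n) s)) +
        (int01 (fun s => ray x s * normalized k (h_ n) s) -
         int01 (fun s => ray x s * f s))).
    apply/funext => n.
    rewrite -int01B; [|exact: bmeasM..].
    rewrite -int01D; [|by apply: bmeasM => //; exact: bmeasB
                      |by apply: bmeasB; exact: bmeasM].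
    by apply: eq_int01 => s _; rewrite /d; ring.
  rewrite -[X in _ --> X]addr0; apply: cvgD.
    apply/cvgr0Pnorm_le => e e0.
    have C0 : 0 < M / m + 2 by rewrite addr_gt0// divr_gt0.
    near=> i; have [_ _ /(_ x) le1] := Hg (phi i).
    apply: le_trans le1 _; rewrite ler_pdivrMr// -ler_pdivrMl//.
    apply: (@le_trans _ _ i%:R); last by rewrite ler_nat leqW.
    by near: i; exact: nbhs_infty_ger.
  rewrite -(subrr (int01 (fun s => ray x s * f s))); apply: cvgB; last exact: cvg_cst.
  apply: (@int01_cvg _ _ _ (M / m)) => [n|||]; [exact: bmeasM|exact: bmeasM| |].
    move=> n s _; rewrite normrM -[leRHS]mul1r ler_pM// /ray indicE.
    by case: (_ \in _); rewrite ?normr1 ?normr0.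
  by move=> s _; apply: cvgM => //; exact: cvg_cst.
have hf psi : bmeas psi ->
    int01 (fun s => psi s * h_ n s) @[n --> \oo] --> int01 (fun s => psi s * f s).
  move=> bpsi.
  have w : weakly_null \oo d psi.
    by apply: (weakly_null_bmeas _ dB drays) => // n; case: (bd n).
  have -> : (fun n => int01 (fun s => psi s * h_ n s)) =
      (fun n => int01 (fun s => psi s * d n s) + int01 (fun s => psi s * f s)).
    apply/funext => n; rewrite -int01D; [|exact: bmeasM..].
    by apply: eq_int01 => s _; rewrite /d; ring.
  by rewrite -[X in _ --> X]add0r; apply: cvgD => //; exact: cvg_cst.
exists f, c; split=> // t.
(* [lyapunov_cvg] is used a second time, now with integration against [f] as the limit functional;
   uniqueness of limits gives [lyapunov k f = A = c f]. *)
have Lf : lyapunov k (h_ n) t @[n --> \oo] --> lyapunov k f t.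
  rewrite (lyapunovE m0 mk kM meask)//.
  exact: (lyapunov_cvg m0 mk kM meask bh hB hf).
rewrite (cvg_unique _ Lf (LA t))// /f mulrC divfK// gt_eqF//.
Unshelve. all: by end_near.
Qed.
End Eigenfunction.

(** * Extension of the kernel beyond the cube and conclusion *)

Lemma lyapunov_eq_on_cube (R : realType) (K K' : R -> R -> R -> R) (f g : R -> R) t t' :
  (forall s u, I01 s -> I01 u -> K t s u = K' t' s u) ->
  (forall s, I01 s -> f s = g s) -> lyapunov K f t = lyapunov K' g t'.
Proof.
by move=> KK fg; apply: eq_int01 => u uI; apply: eq_int01 => s sI; rewrite KK// !fg.
Qed.

Lemma measurable_comp_clamp3 (R : realType) (xi : R * R * R -> R) t :
  measurable_fun I01_3 xi ->
  measurable_fun setT (fun p : R * R => xi (clamp t, clamp p.1, clamp p.2)).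
Proof.
move=> mxi.
have mI : measurable (@I01 R) by exact: measurable_I01.
have mI3 : measurable (@I01_3 R) by exact: (measurableX (measurableX mI mI) mI).
apply: (measurable_comp mI3 _ mxi).
  by move=> _ [p _ <-]; split; [split|]; exact: clamp_I01.
have mc : measurable_fun [set: R] (@clamp R).
  by apply: continuous_measurable_fun; exact: continuous_clamp.
apply/measurable_fun_pair; first apply/measurable_fun_pair => //.
- exact: (measurableT_comp mc (@measurable_fst _ _ _ _)).
- exact: (measurableT_comp mc (@measurable_snd _ _ _ _)).
Qed.

Lemma measurable_comp_clamp2 (R : realType) (xi : R * R -> R) (v w : R * R -> R) :
  measurable_fun I01_2 xi -> measurable_fun setT v -> measurable_fun setT w ->
  measurable_fun setT (fun p : R * R => xi (clamp (v p), clamp (w p))).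
Proof.
move=> mxi mv mw.
have mI2 : measurable (@I01_2 R) by exact: (measurableX (@measurable_I01 R) (@measurable_I01 R)).
apply: (measurable_comp mI2 _ mxi).
  by move=> _ [p _ <-]; split; exact: clamp_I01.
have mc : measurable_fun [set: R] (@clamp R).
  by apply: continuous_measurable_fun; exact: continuous_clamp.
by apply/measurable_fun_pair; [exact: (measurableT_comp mc mv)|exact: (measurableT_comp mc mw)].
Qed.

Lemma bounded_le (R : realType) (T : Type) (D : set T) (f : T -> R) :
  [bounded f x | x in D] -> exists B, forall x, D x -> `|f x| <= B.
Proof.
by move=> [N [_ HN]]; exists (N + 1) => x Dx; apply: (HN (N + 1)) => //; rewrite ltrDl.
Qed.

Theorem proposition2p3 (R : realType)
  (xi1 : R * R * R -> R) (xi2 xi3 : R * R -> R)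
  (hxi1 : bounded_measurable I01_3 xi1)
  (hxi2 : bounded_measurable I01_2 xi2)
  (hxi3 : bounded_measurable I01_2 xi3)
  (beta : R) (hbeta : 0 < beta)
  (J3 J J1 alpha : R)
  (hparam : [/\ J3 != 0, J != 0, J1 != 0 & alpha != 0] \/
            [/\ J3 != 0, J = 0, J1 = 0 & alpha = 0])
  (* L is an operator on C[0,1] *)
  (hL : forall f : R -> R, C01 f ->
        C01 (lyapunov (kernelK J3 J J1 alpha beta xi1 xi2 xi3) f))
  (lambda : R) (hlambda : 0 < lambda) :
  exists2 f : R -> R, C01_nonneg_nonzero f &
    forall t : R, I01 t ->
      lyapunov (kernelK J3 J J1 alpha beta xi1 xi2 xi3) f t = lambda * f t.
Proof.
set K := kernelK J3 J J1 alpha beta xi1 xi2 xi3.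
have [m1 /bounded_le[B1 b1]] := hxi1.
have [m2 /bounded_le[B2 b2]] := hxi2.
have [m3 /bounded_le[B3 b3]] := hxi3.
(* [E] bounds the absolute value of the exponent on the cube; the final 2 bounds [u + v]. *)
pose E := `|J3 * beta| * B1 + `|J * beta| * B2 + `|J1 * beta| * (B3 + B3)
  + `|alpha * beta| * 2.
(* Clamping all arguments makes the bounds and the measurability global without changing the kernel
   on the cube. *)
pose k t s u := K (clamp t) (clamp s) (clamp u).
have kE t s u : expR (- E) <= k t s u <= expR E.
  rewrite /k /K /kernelK !ler_expR -ler_norml.
  have It := clamp_I01 t; have Is := clamp_I01 s; have Iu := clamp_I01 u.
  rewrite /E; apply: le_trans (ler_normD _ _) _; apply: lerD; last first.
    rewrite normrM ler_wpM2l//.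
    move: Is Iu; rewrite /I01/= !in_itv/= => /andP[s0 s1] /andP[u0 u1].
    by rewrite ger0_norm ?addr_ge0//; lra.
  apply: le_trans (ler_normD _ _) _; apply: lerD; last first.
    rewrite normrM ler_wpM2l// (le_trans (ler_normD _ _))// lerD//; exact: b3.
  apply: le_trans (ler_normD _ _) _; apply: lerD.
    by rewrite normrM ler_wpM2l//; apply: b1.
  by rewrite normrM ler_wpM2l//; apply: b2.
have mk t s u : expR (- E) <= k t s u by case/andP: (kE t s u).
have kM t s u : k t s u <= expR E by case/andP: (kE t s u).
have m0 : 0 < expR (- E) :> R by exact: expR_gt0.
have mc : measurable_fun [set: R] (@clamp R).
  by apply: continuous_measurable_fun; exact: continuous_clamp.
have mfst : measurable_fun [set: R * R] (fst : R * R -> R) by exact: measurable_fst.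
have msnd : measurable_fun [set: R * R] (snd : R * R -> R) by exact: measurable_snd.
have meask t : measurable_fun setT (fun p : R * R => k t p.1 p.2).
  have mexp : measurable_fun [set: R] (@expR R) by exact: measurable_expR.
  rewrite /k /K /kernelK; apply: (measurableT_comp mexp).
  apply: measurable_funD; last first.
    apply: measurable_funM => //; apply: measurable_funD.
      exact: (measurableT_comp mc mfst).
    exact: (measurableT_comp mc msnd).
  apply: measurable_funD; last first.
    apply: measurable_funM => //; apply: measurable_funD;
      exact: (measurable_comp_clamp2 m3).
  apply: measurable_funD; apply: measurable_funM => //.
    exact: measurable_comp_clamp3.
  exact: (measurable_comp_clamp2 m2).
have Kk (f : R -> R) t : lyapunov k f t = lyapunov K f (clamp t).
  by apply: lyapunov_eq_on_cube => // s u sI uI; rewrite /k !(clamp_id sI, clamp_id uI).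
have cont f : continuous f -> continuous (lyapunov k f).
  move=> cf; rewrite (funext (Kk f)).
  by have /hL/continuous_comp_clamp : C01 f by exact: continuous_subspaceT.
have [f [c [bf f0 c0 Lf]]] := eigenfunction m0 mk kM meask cont.
(* The operator is quadratic, so scaling by [lambda / c] turns the eigenvalue [c] into [lambda]. *)
pose g x := lambda / c * f x.
(* So far [f] is only bounded and measurable; the eigenvalue equation exhibits it as a multiple of a
   continuous image. *)
have cf : continuous f.
  have -> : f = (fun t => c^-1 * lyapunov k f t).
    by apply/funext => t; rewrite Lf mulKf// gt_eqF.
  move=> t; apply: cvgM; first exact: cvg_cst.
  exact: (continuous_lyapunov_bmeas m0 mk kM meask cont bf).
have g0 x : 0 < g x by rewrite mulr_gt0// divr_gt0.
exists g.
  split; last by move=> /(_ 0) /=; rewrite /I01/= in_itv/= lexx ler01 => /(_ isT) g00;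
    have := g0 0; rewrite g00 ltxx.
  split; last by move=> x _; exact: ltW.
  apply: continuous_subspaceT => x; apply: cvgM; [exact: cvg_cst|exact: cf].
move=> t tI; rewrite -(clamp_id tI) -Kk.
rewrite (lyapunovZ m0 mk kM meask _ _ bf) clamp_id// Lf /g.
by field; rewrite gt_eqF.
Qed.
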